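(* Let $R$ be a commutative ring and let $M$ be a complex of $R$-modules, regarded as an object of the derived category $D(R)$. Suppose that either (i) $H^i(M)=0$ for all $i\ll 0$ (for example, $M$ is a module), or (ii) the prime ideals of $R$ satisfy the descending chain condition. Then $\operatorname{supp} M=\emptyset$ if and only if $M=0$ in $D(R)$.
   Context: $R$ is an arbitrary commutative ring (not assumed Noetherian). For a finite sequence $\underline{x}=x_1,\dots,x_n\in R$, let $K_\infty(\underline{x})=(R\to R_{x_1})\otimes_R\cdots\otimes_R(R\to R_{x_n})$, where each $R\to R_{x_i}$ is the localisation map viewed as a complex in degrees $0$ and $1$ (for the empty sequence it is $R$). For a complex $N$ of $R$-modules put $H^iK_\infty(\underline{x}:N)=H^i(K_\infty(\underline{x})\otimes_R N)$. Definition (small support). For a complex $M$ of $R$-modules, a prime $\mathfrak p\in\operatorname{Spec}R$ lies in $\operatorname{supp}M$ if for every finite sequence $\underline{x}=x_1,\dots,x_n\in\mathfrak p$ there is some $i\in\mathbb Z$ with $H^iK_\infty(\underline{x}:M_{\mathfrak p})\neq 0$. ''$M=0$'' means $M$ is zero in $D(R)$, i.e. acyclic. *)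

(* Defs.v *)
From HB Require Import structures.
From mathcomp Require Import all_boot all_order all_algebra.
From mathcomp Require Import zify ring.
From mathcomp Require Import boolp classical_sets functions cardinality.

Set Implicit Arguments.
Unset Strict Implicit.
Unset Printing Implicit Defensive.

Import Order.TTheory GRing.Theory Num.Theory.
Local Open Scope ring_scope.
Local Open Scope quotient_scope.
Local Open Scope classical_set_scope.

(* Rings are [comPzRingType]s, so that the zero ring is allowed.  All           *)
(* predicates on [R] are boolean; with the classical axioms of [boolp] these    *)
(* are arbitrary subsets.                                                       *)

Definition is_zero (R : pzRingType) (V : lmodType R) : Prop :=
  forall v : V, v = 0.

(* A set with operations satisfying the module axioms up to an equivalence      *)
(* relation; its quotient is a module.                                          *)
Record premodule (R : pzRingType) := PreModule {
  pm_sort :> choiceType;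
  pm_eq : pm_sort -> pm_sort -> Prop;
  pm_zero : pm_sort;
  pm_opp : pm_sort -> pm_sort;
  pm_add : pm_sort -> pm_sort -> pm_sort;
  pm_scale : R -> pm_sort -> pm_sort;
  pm_refl : forall x, pm_eq x x;
  pm_sym : forall x y, pm_eq x y -> pm_eq y x;
  pm_trans : forall x y z, pm_eq x y -> pm_eq y z -> pm_eq x z;
  pm_oppE : forall x y, pm_eq x y -> pm_eq (pm_opp x) (pm_opp y);
  pm_addE : forall x x' y y',
    pm_eq x x' -> pm_eq y y' -> pm_eq (pm_add x y) (pm_add x' y');
  pm_scaleE : forall a x y, pm_eq x y -> pm_eq (pm_scale a x) (pm_scale a y);
  pm_addA : forall x y z,
    pm_eq (pm_add x (pm_add y z)) (pm_add (pm_add x y) z);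
  pm_addC : forall x y, pm_eq (pm_add x y) (pm_add y x);
  pm_add0 : forall x, pm_eq (pm_add pm_zero x) x;
  pm_addN : forall x, pm_eq (pm_add (pm_opp x) x) pm_zero;
  pm_scaleA : forall a b x,
    pm_eq (pm_scale a (pm_scale b x)) (pm_scale (a * b) x);
  pm_scale1 : forall x, pm_eq (pm_scale 1 x) x;
  pm_scaleDr : forall a x y,
    pm_eq (pm_scale a (pm_add x y)) (pm_add (pm_scale a x) (pm_scale a y));
  pm_scaleDl : forall a b x,
    pm_eq (pm_scale (a + b) x) (pm_add (pm_scale a x) (pm_scale b x)) }.

Section Quotient.
Variables (R : pzRingType) (P : premodule R).

Definition pm_eqb (x y : P) : bool := `[< pm_eq x y >].

Lemma pm_eqb_refl : reflexive pm_eqb.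
Proof. by move=> x; apply/asboolP/pm_refl. Qed.

Lemma pm_eqb_sym : symmetric pm_eqb.
Proof. by move=> x y; apply/asboolP/asboolP; apply: pm_sym. Qed.

Lemma pm_eqb_trans : transitive pm_eqb.
Proof.
by move=> y x z /asboolP xy /asboolP yz; apply/asboolP/(pm_trans xy yz).
Qed.

Canonical pm_equiv := EquivRel pm_eqb pm_eqb_refl pm_eqb_sym pm_eqb_trans.

Definition quotient := {eq_quot pm_equiv}.
HB.instance Definition _ := EqQuotient.on quotient.
HB.instance Definition _ := Choice.on quotient.

Definition qpi (x : P) : quotient := \pi_quotient x.

Lemma qpiP (x y : P) : qpi x = qpi y <-> pm_eq x y.
Proof.
split=> [/eqP|h]; first by rewrite /qpi eqmodE => /asboolP.
by apply/eqP; rewrite /qpi eqmodE; apply/asboolP.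
Qed.

Lemma qpi_repr (q : quotient) : qpi (repr q) = q.
Proof. exact: reprK. Qed.

Lemma repr_qpi (x : P) : pm_eq (repr (qpi x)) x.
Proof. by apply/qpiP; rewrite qpi_repr. Qed.

Lemma qpiW (T : quotient -> Prop) : (forall x, T (qpi x)) -> forall q, T q.
Proof. by move=> h q; rewrite -(qpi_repr q). Qed.

Definition q_zero : quotient := qpi (pm_zero P).
Definition q_opp (q : quotient) : quotient := qpi (pm_opp (repr q)).
Definition q_add (q r : quotient) : quotient := qpi (pm_add (repr q) (repr r)).
Definition q_scale (a : R) (q : quotient) : quotient :=
  qpi (pm_scale a (repr q)).

Lemma qpi_opp x : q_opp (qpi x) = qpi (pm_opp x).
Proof. by apply/qpiP/pm_oppE/repr_qpi. Qed.

Lemma qpi_add x y : q_add (qpi x) (qpi y) = qpi (pm_add x y).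
Proof. by apply/qpiP/pm_addE; apply: repr_qpi. Qed.

Lemma qpi_scale a x : q_scale a (qpi x) = qpi (pm_scale a x).
Proof. by apply/qpiP/pm_scaleE/repr_qpi. Qed.

Lemma q_addA : associative q_add.
Proof.
elim/qpiW=> x; elim/qpiW=> y; elim/qpiW=> z.
by rewrite !qpi_add; apply/qpiP/pm_addA.
Qed.

Lemma q_addC : commutative q_add.
Proof.
by elim/qpiW=> x; elim/qpiW=> y; rewrite !qpi_add; apply/qpiP/pm_addC.
Qed.

Lemma q_add0 : left_id q_zero q_add.
Proof. by elim/qpiW=> x; rewrite qpi_add; apply/qpiP/pm_add0. Qed.

Lemma q_addN : left_inverse q_zero q_opp q_add.
Proof. by elim/qpiW=> x; rewrite qpi_opp qpi_add; apply/qpiP/pm_addN. Qed.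

HB.instance Definition _ :=
  GRing.isZmodule.Build quotient q_addA q_addC q_add0 q_addN.

Lemma q_scaleA a b q : q_scale a (q_scale b q) = q_scale (a * b) q.
Proof. by elim/qpiW: q => x; rewrite !qpi_scale; apply/qpiP/pm_scaleA. Qed.

Lemma q_scale1 : left_id 1 q_scale.
Proof. by elim/qpiW=> x; rewrite qpi_scale; apply/qpiP/pm_scale1. Qed.

Lemma q_scaleDr : right_distributive q_scale +%R.
Proof.
move=> a; elim/qpiW=> x; elim/qpiW=> y.
by rewrite -![_ + _]/(q_add _ _) qpi_add !qpi_scale qpi_add;
  apply/qpiP/pm_scaleDr.
Qed.

Lemma q_scaleDl q : {morph q_scale^~ q : a b / a + b}.
Proof.
elim/qpiW: q => x a b.
by rewrite -![_ + _ in RHS]/(q_add _ _) !qpi_scale qpi_add;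
  apply/qpiP/pm_scaleDl.
Qed.

HB.instance Definition _ := GRing.Zmodule_isLmodule.Build R quotient
  q_scaleA q_scale1 q_scaleDr q_scaleDl.

Lemma qpi0 : qpi (pm_zero P) = 0. Proof. by []. Qed.

Lemma qpiD x y : qpi (pm_add x y) = qpi x + qpi y.
Proof. by rewrite -qpi_add. Qed.

Lemma qpiZ a x : qpi (pm_scale a x) = a *: qpi x.
Proof. by rewrite -qpi_scale. Qed.

End Quotient.

Arguments quotient {R} P.

Section QuotientMap.
Variables (R : pzRingType) (P Q : premodule R) (f : P -> Q).

Definition qmap (q : quotient P) : quotient Q := qpi (f (repr q)).

Hypothesis f_eq : forall x y, pm_eq x y -> pm_eq (f x) (f y).

Lemma qmap_qpi x : qmap (qpi x) = qpi (f x).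
Proof. by apply/qpiP/f_eq/repr_qpi. Qed.

Hypothesis fD : forall x y, pm_eq (f (pm_add x y)) (pm_add (f x) (f y)).
Hypothesis fZ : forall a x, pm_eq (f (pm_scale a x)) (pm_scale a (f x)).

Lemma qmap_linear : linear qmap.
Proof.
move=> a; elim/qpiW=> x; elim/qpiW=> y.
rewrite -qpiZ -qpiD !qmap_qpi -qpiZ -qpiD; apply/qpiP.
by apply: pm_trans (fD _ _) _; apply: pm_addE; [apply: fZ|apply: pm_refl].
Qed.

End QuotientMap.

Section Localization.
Variables (R : comPzRingType) (S : mulrClosed R).

Definition denom := {s : R | s \in S}.
Definition denom1 : denom := exist _ 1 (rpred1 S).
Definition denomM (s t : denom) : denom :=
  exist _ (sval s * sval t) (rpredM (valP s) (valP t)).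

Section Module.
Variable V : lmodType R.
Implicit Types x y z : (V * denom)%type.

(* [(v, s)] stands for the fraction v / s *)
Definition frac_eq x y : Prop :=
  exists2 u : R, u \in S &
    u *: (sval y.2 *: x.1) = u *: (sval x.2 *: y.1).
Definition frac_zero : V * denom := (0, denom1).
Definition frac_opp x : V * denom := (- x.1, x.2).
Definition frac_add x y : V * denom :=
  (sval y.2 *: x.1 + sval x.2 *: y.1, denomM x.2 y.2).
Definition frac_scale (a : R) x : V * denom := (a *: x.1, x.2).

Lemma frac_refl x : frac_eq x x.
Proof. by exists 1; rewrite ?rpred1. Qed.

Lemma frac_sym x y : frac_eq x y -> frac_eq y x.
Proof. by case=> u Su e; exists u. Qed.

Lemma frac_trans x y z : frac_eq x y -> frac_eq y z -> frac_eq x z.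
Proof.
case: x y z => [x s] [y t] [z r] [u Su /= e1] [v Sv /= e2].
exists (u * v * sval t) => /=; first by rewrite !rpredM ?(valP t).
rewrite (_ : (u * v * sval t) *: (sval r *: x) =
    (v * sval r) *: (u *: (sval t *: x))); last first.
  by rewrite !scalerA; congr (_ *: _); ring.
rewrite e1 (_ : (v * sval r) *: (u *: (sval s *: y)) =
    (u * sval s) *: (v *: (sval r *: y))); last first.
  by rewrite !scalerA; congr (_ *: _); ring.
rewrite e2 !scalerA; congr (_ *: _). ring.
Qed.

Lemma frac_oppE x y : frac_eq x y -> frac_eq (frac_opp x) (frac_opp y).
Proof. by case=> u Su e; exists u => //=; rewrite !scalerN e. Qed.

Lemma frac_addE x x' y y' :
  frac_eq x x' -> frac_eq y y' -> frac_eq (frac_add x y) (frac_add x' y').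
Proof.
case: x x' y y' => [x s] [x' s'] [y t] [y' t'] [u Su /= e1] [v Sv /= e2].
exists (u * v) => /=; first by rewrite rpredM.
have -> : (u * v) *: ((sval s' * sval t') *: (sval t *: x + sval s *: y)) =
    (v * (sval t * sval t')) *: (u *: (sval s' *: x)) +
    (u * (sval s * sval s')) *: (v *: (sval t' *: y)).
  by rewrite !scalerDr !scalerA; congr (_ *: _ + _ *: _); ring.
by rewrite e1 e2 !scalerDr !scalerA; congr (_ *: _ + _ *: _); ring.
Qed.

Lemma frac_scaleE a x y :
  frac_eq x y -> frac_eq (frac_scale a x) (frac_scale a y).
Proof.
case: x y => [x s] [y t] [u Su /= e]; exists u => //=.
have -> : u *: (sval t *: (a *: x)) = a *: (u *: (sval t *: x)).
  by rewrite !scalerA; congr (_ *: _); ring.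
by rewrite e !scalerA; congr (_ *: _); ring.
Qed.

Lemma frac_addA x y z :
  frac_eq (frac_add x (frac_add y z)) (frac_add (frac_add x y) z).
Proof.
exists 1; rewrite ?rpred1 //= !scalerDr !scalerA addrA.
by congr (_ *: _ + _ *: _ + _ *: _); ring.
Qed.

Lemma frac_addC x y : frac_eq (frac_add x y) (frac_add y x).
Proof.
exists 1; rewrite ?rpred1 //= addrC !scalerDr !scalerA.
by congr (_ *: _ + _ *: _); ring.
Qed.

Lemma frac_add0 x : frac_eq (frac_add frac_zero x) x.
Proof.
exists 1; rewrite ?rpred1 //= scaler0 add0r !scalerA.
by congr (_ *: _); ring.
Qed.

Lemma frac_addN x : frac_eq (frac_add (frac_opp x) x) frac_zero.
Proof. by exists 1; rewrite ?rpred1 //= scalerN addNr !scaler0. Qed.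

Lemma frac_scaleA a b x :
  frac_eq (frac_scale a (frac_scale b x)) (frac_scale (a * b) x).
Proof. by exists 1; rewrite ?rpred1 //= !scalerA; congr (_ *: _); ring. Qed.

Lemma frac_scale1 x : frac_eq (frac_scale 1 x) x.
Proof. by exists 1; rewrite ?rpred1 //= !scale1r. Qed.

Lemma frac_scaleDr a x y :
  frac_eq (frac_scale a (frac_add x y))
          (frac_add (frac_scale a x) (frac_scale a y)).
Proof.
exists 1; rewrite ?rpred1 //= !scalerDr !scalerA.
by congr (_ *: _ + _ *: _); ring.
Qed.

Lemma frac_scaleDl a b x :
  frac_eq (frac_scale (a + b) x) (frac_add (frac_scale a x) (frac_scale b x)).
Proof.
exists 1; rewrite ?rpred1 //= !scalerDr !scalerA -scalerDl.
by congr (_ *: _); ring.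
Qed.

Definition frac_premodule : premodule R :=
  @PreModule R (V * denom)%type frac_eq frac_zero frac_opp frac_add frac_scale
    frac_refl frac_sym frac_trans frac_oppE frac_addE frac_scaleE
    frac_addA frac_addC frac_add0 frac_addN
    frac_scaleA frac_scale1 frac_scaleDr frac_scaleDl.

Definition localization : lmodType R := quotient frac_premodule.

Definition frac (v : V) (s : denom) : localization :=
  qpi ((v, s) : frac_premodule).

Definition loc_can (v : V) : localization := frac v denom1.

Lemma loc_can_linear : linear loc_can.
Proof.
move=> a v w; rewrite /loc_can /frac -qpiZ -qpiD; apply/qpiP.
exists 1; rewrite ?rpred1 //= !scalerDr !scalerA.
by congr (_ *: _ + _ *: _); ring.
Qed.

HB.instance Definition _ :=
  GRing.isLinear.Build R V localization _ loc_can loc_can_linear.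

End Module.

Section Map.
Variables (V W : lmodType R) (f : {linear V -> W}).

Definition frac_map (x : frac_premodule V) : frac_premodule W := (f x.1, x.2).

Lemma frac_map_eq x y : pm_eq x y -> pm_eq (frac_map x) (frac_map y).
Proof. by case=> u Su e; exists u => //=; have := congr1 f e; rewrite !(linearZZ f). Qed.

Definition loc_map : localization V -> localization W := qmap frac_map.

Lemma loc_map_frac v s : loc_map (frac v s) = frac (f v) s.
Proof. exact: (qmap_qpi frac_map_eq). Qed.

Lemma loc_map_linear : linear loc_map.
Proof.
apply: (qmap_linear frac_map_eq) => [x y|a x].
  by rewrite /frac_map /= (linearD f) !(linearZZ f); apply: frac_refl.
by rewrite /frac_map /= (linearZZ f); apply: frac_refl.
Qed.

HB.instance Definition _ :=
  GRing.isLinear.Build R (localization V) (localization W) _ loc_map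
    loc_map_linear.

End Map.
End Localization.

Arguments loc_can {R} S {V} v.
Arguments loc_map {R} S {V W} f x.

Section Tensor.
Variable R : comPzRingType.

Section Module.
Variables V W : lmodType R.

(* The list [:: (v1, w1); ...; (vn, wn)] stands for the sum of the vi (x) wi.   *)
(* The relation is the least congruence making (x) bilinear and balanced; no    *)
(* rule is needed for negatives, as (- v) (x) w + v (x) w = 0 (x) w = 0.        *)
Inductive tens_eq : seq (V * W) -> seq (V * W) -> Prop :=
| tens_refl s : tens_eq s s
| tens_sym s t : tens_eq s t -> tens_eq t s
| tens_trans s t u : tens_eq s t -> tens_eq t u -> tens_eq s u
| tens_cat s s' t t' : tens_eq s s' -> tens_eq t t' ->
    tens_eq (s ++ t) (s' ++ t')
| tens_catC s t : tens_eq (s ++ t) (t ++ s)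
| tens_0 w : tens_eq [:: (0, w)] [::]
| tens_Dl v v' w : tens_eq [:: (v + v', w)] [:: (v, w); (v', w)]
| tens_Dr v w w' : tens_eq [:: (v, w + w')] [:: (v, w); (v, w')]
| tens_Z a v w : tens_eq [:: (a *: v, w)] [:: (v, a *: w)].

Definition tens_opp (s : seq (V * W)) := [seq (- x.1, x.2) | x <- s].
Definition tens_scale (a : R) (s : seq (V * W)) := [seq (a *: x.1, x.2) | x <- s].

Lemma tens_scaleE a s t :
  tens_eq s t -> tens_eq (tens_scale a s) (tens_scale a t).
Proof.
elim=> {s t} /=.
- by move=> s; apply: tens_refl.
- by move=> s t _; apply: tens_sym.
- by move=> s t u _ st _; apply: tens_trans.
- by move=> s s' t t' _ ? _ ?; rewrite /tens_scale !map_cat; apply: tens_cat.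
- by move=> s t; rewrite /tens_scale !map_cat; apply: tens_catC.
- by move=> w; rewrite scaler0; apply: tens_0.
- by move=> v v' w; rewrite scalerDr; apply: tens_Dl.
- by move=> v w w'; apply: tens_Dr.
- by move=> b v w; rewrite scalerA mulrC -scalerA; apply: tens_Z.
Qed.

Lemma tens_oppE s t : tens_eq s t -> tens_eq (tens_opp s) (tens_opp t).
Proof.
have e u : tens_opp u = tens_scale (- 1) u.
  by apply: eq_map => x; rewrite scaleN1r.
by rewrite !e; apply: tens_scaleE.
Qed.

Lemma tens_addA s t u : tens_eq (s ++ (t ++ u)) ((s ++ t) ++ u).
Proof. by rewrite catA; apply: tens_refl. Qed.

Lemma tens_add0 s : tens_eq ([::] ++ s) s.
Proof. exact: tens_refl. Qed.

Lemma tens_catACA s t u v :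
  tens_eq ((s ++ t) ++ (u ++ v)) ((s ++ u) ++ (t ++ v)).
Proof.
rewrite -!catA; apply: tens_cat (tens_refl _) _.
by rewrite !catA; apply: tens_cat (tens_catC _ _) (tens_refl _).
Qed.

Lemma tens_addN s : tens_eq (tens_opp s ++ s) [::].
Proof.
elim: s => [|[v w] s IH]; first exact: tens_refl.
rewrite -[tens_opp _]/([:: (- v, w)] ++ tens_opp s) -[_ :: s]cat1s.
apply: tens_trans (tens_catACA _ _ _ _) _.
apply: tens_trans (tens_cat (tens_refl _) IH) _; rewrite cats0.
apply: tens_trans (tens_sym (tens_Dl _ _ _)) _.
by rewrite addNr; apply: tens_0.
Qed.

Lemma tens_scaleA a b s :
  tens_eq (tens_scale a (tens_scale b s)) (tens_scale (a * b) s).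
Proof.
rewrite /tens_scale -map_comp (eq_map (g := fun x => ((a * b) *: x.1, x.2))).
  exact: tens_refl.
by move=> x /=; rewrite scalerA.
Qed.

Lemma tens_scale1 s : tens_eq (tens_scale 1 s) s.
Proof.
rewrite /tens_scale (eq_map (g := id)) ?map_id; first exact: tens_refl.
by case=> x y /=; rewrite scale1r.
Qed.

Lemma tens_scaleDr a s t :
  tens_eq (tens_scale a (s ++ t)) (tens_scale a s ++ tens_scale a t).
Proof. by rewrite /tens_scale map_cat; apply: tens_refl. Qed.

Lemma tens_scaleDl a b s :
  tens_eq (tens_scale (a + b) s) (tens_scale a s ++ tens_scale b s).
Proof.
elim: s => [|[v w] s IH]; first exact: tens_refl.
rewrite -[X in tens_eq X]/([:: ((a + b) *: v, w)] ++ tens_scale (a + b) s).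
rewrite -[tens_scale a _]/([:: (a *: v, w)] ++ tens_scale a s).
rewrite -[tens_scale b _]/([:: (b *: v, w)] ++ tens_scale b s).
apply: tens_trans (tens_catACA _ _ _ _); apply: tens_cat IH.
by rewrite scalerDl; apply: tens_Dl.
Qed.

Definition tens_premodule : premodule R :=
  @PreModule R (seq (V * W)) tens_eq [::] tens_opp cat tens_scale
    tens_refl tens_sym tens_trans tens_oppE tens_cat tens_scaleE
    tens_addA tens_catC tens_add0 tens_addN
    tens_scaleA tens_scale1 tens_scaleDr tens_scaleDl.

Definition tensor : lmodType R := quotient tens_premodule.

Definition pure (v : V) (w : W) : tensor :=
  qpi ([:: (v, w)] : tens_premodule).

Lemma tensor_ind (P : tensor -> Prop) :
  P 0 -> (forall v w t, P t -> P (pure v w + t)) -> forall t, P t.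
Proof.
move=> P0 PD; elim/qpiW; elim=> [|[v w] s IH]; first exact: P0.
by have := PD v w _ IH; rewrite /pure -qpiD.
Qed.

End Module.

Section Map.
Variables (V V' W W' : lmodType R).
Variables (f : {linear V -> V'}) (g : {linear W -> W'}).

Definition tens_map (s : tens_premodule V W) : tens_premodule V' W' :=
  [seq (f x.1, g x.2) | x <- s].

Lemma tens_map_eq x y : pm_eq x y -> pm_eq (tens_map x) (tens_map y).
Proof.
rewrite /pm_eq /=; elim=> {x y} /=.
- by move=> s; apply: tens_refl.
- by move=> s t _; apply: tens_sym.
- by move=> s t u _ st _; apply: tens_trans.
- by move=> s s' t t' _ ? _ ?; rewrite /tens_map !map_cat; apply: tens_cat.
- by move=> s t; rewrite /tens_map !map_cat; apply: tens_catC.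
- by move=> w; rewrite linear0; apply: tens_0.
- by move=> v v' w; rewrite linearD; apply: tens_Dl.
- by move=> v w w'; rewrite linearD; apply: tens_Dr.
- by move=> a v w; rewrite !linearZ; apply: tens_Z.
Qed.

Definition tensor_map : tensor V W -> tensor V' W' := qmap tens_map.

Lemma tensor_map_linear : linear tensor_map.
Proof.
apply: (qmap_linear tens_map_eq) => [x y|a x].
  by rewrite /tens_map map_cat; apply: pm_refl.
rewrite /pm_eq /= /tens_map /tens_scale -!map_comp.
rewrite (eq_map (g := (fun x => (a *: x.1, x.2)) \o (fun x => (f x.1, g x.2)))).
  exact: tens_refl.
by move=> z /=; rewrite linearZ.
Qed.

HB.instance Definition _ :=
  GRing.isLinear.Build R (tensor V W) (tensor V' W') _ tensor_map
    tensor_map_linear.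

Lemma tensor_map_pure v w : tensor_map (pure v w) = pure (f v) (g w).
Proof. exact: (qmap_qpi tens_map_eq). Qed.

End Map.

Lemma tensor_map_comp (V V' V'' W W' W'' : lmodType R)
    (f : {linear V -> V'}) (f' : {linear V' -> V''})
    (g : {linear W -> W'}) (g' : {linear W' -> W''})
    (h : {linear V -> V''}) (l : {linear W -> W''}) x :
  h =1 f' \o f -> l =1 g' \o g ->
  tensor_map f' g' (tensor_map f g x) = tensor_map h l x.
Proof.
move=> hE lE; elim/tensor_ind: x => [|v w x IH].
  by rewrite !(linear0 (tensor_map _ _)).
by rewrite !linearD /= IH !tensor_map_pure hE lE.
Qed.

Lemma pure0l (V W : lmodType R) (w : W) : pure (0 : V) w = 0.
Proof. by apply/qpiP; apply: tens_0. Qed.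

Lemma pure0r (V W : lmodType R) (v : V) : pure v (0 : W) = 0.
Proof.
rewrite -(scale0r (0 : W)) -(pure0l V (0 : W)) -(scale0r v).
by apply/qpiP/tens_sym/tens_Z.
Qed.

Lemma tensor_map0l (V V' W W' : lmodType R) (g : {linear W -> W'}) x :
  tensor_map (\0 : {linear V -> V'}) g x = 0.
Proof.
elim/tensor_ind: x => [|v w x IH]; first by rewrite linear0.
by rewrite linearD /= IH addr0 tensor_map_pure pure0l.
Qed.

Lemma tensor_map0r (V V' W W' : lmodType R) (f : {linear V -> V'}) x :
  tensor_map f (\0 : {linear W -> W'}) x = 0.
Proof.
elim/tensor_ind: x => [|v w x IH]; first by rewrite linear0.
by rewrite linearD /= IH addr0 tensor_map_pure pure0r.
Qed.

End Tensor.

Section DirectSum.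
Variables (R : pzRingType) (I : Type) (V : I -> lmodType R).

Definition dprod := forall i, V i.
HB.instance Definition _ := gen_eqMixin dprod.
HB.instance Definition _ := gen_choiceMixin dprod.

Implicit Types s t u : dprod.

Definition dprod_zero : dprod := fun=> 0.
Definition dprod_opp t : dprod := fun i => - t i.
Definition dprod_add s t : dprod := fun i => s i + t i.
Definition dprod_scale (a : R) t : dprod := fun i => a *: t i.

Lemma dprod_addA : associative dprod_add.
Proof. by move=> s t u; apply: functional_extensionality_dep => i; apply: addrA. Qed.
Lemma dprod_addC : commutative dprod_add.
Proof. by move=> s t; apply: functional_extensionality_dep => i; apply: addrC. Qed.
Lemma dprod_add0 : left_id dprod_zero dprod_add.
Proof. by move=> t; apply: functional_extensionality_dep => i; apply: add0r. Qed.
Lemma dprod_addN : left_inverse dprod_zero dprod_opp dprod_add.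
Proof. by move=> t; apply: functional_extensionality_dep => i; apply: addNr. Qed.

HB.instance Definition _ :=
  GRing.isZmodule.Build dprod dprod_addA dprod_addC dprod_add0 dprod_addN.

Lemma dprod_scaleA a b t :
  dprod_scale a (dprod_scale b t) = dprod_scale (a * b) t.
Proof. by apply: functional_extensionality_dep => i; apply: scalerA. Qed.
Lemma dprod_scale1 : left_id 1 dprod_scale.
Proof. by move=> t; apply: functional_extensionality_dep => i; apply: scale1r. Qed.
Lemma dprod_scaleDr : right_distributive dprod_scale +%R.
Proof. by move=> a s t; apply: functional_extensionality_dep => i; apply: scalerDr. Qed.
Lemma dprod_scaleDl t : {morph dprod_scale^~ t : a b / a + b}.
Proof. by move=> a b; apply: functional_extensionality_dep => i; apply: scalerDl. Qed.

HB.instance Definition _ := GRing.Zmodule_isLmodule.Build R dprod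
  dprod_scaleA dprod_scale1 dprod_scaleDr dprod_scaleDl.

Variable P : pred I.

(* Membership in the direct sum of the [V i] with [P i], seen as families       *)
(* indexed by all of [I] that vanish outside [P].                               *)
Definition dsum_pred : {pred dprod} := fun t =>
  `[< (forall i, ~~ P i -> t i = 0) /\ finite_set [set i | t i <> 0] >].

Lemma dsum_submod_closed : submod_closed dsum_pred.
Proof.
split=> [|a s t /asboolP[s0 sfin] /asboolP[t0 tfin]]; apply/asboolP; split=> //.
- by rewrite (_ : [set _ | _] = set0) //; apply/seteqP; split=> i //=.
- move=> i Pi; rewrite -[LHS]/(a *: s i + t i) s0 // t0 //.
  by rewrite scaler0 addr0.
- apply: (@sub_finite_set _ _ ([set i | s i <> 0] `|` [set i | t i <> 0])).
    move=> i /= nz; case: (pselect (s i = 0)) => [s_i|]; last by left.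
    right=> t_i; apply: nz; rewrite -[LHS]/(a *: s i + t i) s_i t_i.
    by rewrite scaler0 addr0.
  by rewrite finite_setU; split.
Qed.

HB.instance Definition _ :=
  GRing.isSubmodClosed.Build R dprod dsum_pred dsum_submod_closed.

Definition dsum := {t : dprod | t \in dsum_pred}.
HB.instance Definition _ := SubChoice.on dsum.
HB.instance Definition _ := [SubChoice_isSubLmodule of dsum by <:].

Lemma dsum_out (t : dsum) i : ~~ P i -> val t i = 0.
Proof. by case: t => t /= /asboolP[t0 _]; apply: t0. Qed.

Lemma dsum_fin (t : dsum) : finite_set [set i | val t i <> 0].
Proof. by case: t => t /= /asboolP[]. Qed.

Lemma dsum_eqP (s t : dsum) : (forall i, val s i = val t i) -> s = t.
Proof. by move=> st; apply/val_inj/functional_extensionality_dep. Qed.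

End DirectSum.

(* Cohomologically graded complexes.  A differential is given for each pair of  *)
(* degrees, and vanishes unless they are consecutive; this avoids transport     *)
(* along equalities between degrees.                                            *)
Record complex (R : pzRingType) := Complex {
  cobj :> int -> lmodType R;
  cdiff : forall i j : int, {linear cobj i -> cobj j};
  cdiff_shape : forall i j x, j != i + 1 -> cdiff i j x = 0;
  cdiffK : forall i j k x, cdiff j k (cdiff i j x) = 0 }.

Arguments cdiff {R} c i j.

Section Cohomology.
Variables (R : pzRingType) (C : complex R) (i : int).

Definition cocycle_pred : {pred C i} := fun x => cdiff C i (i + 1) x == 0.

Lemma cocycle_submod_closed : submod_closed cocycle_pred.
Proof.
split=> [|a x y /eqP x0 /eqP y0]; first by rewrite unfold_in linear0.
by rewrite unfold_in linearP x0 y0 scaler0 addr0.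
Qed.

HB.instance Definition _ :=
  GRing.isSubmodClosed.Build R (C i) cocycle_pred cocycle_submod_closed.

Definition cocycle := {x : C i | x \in cocycle_pred}.
HB.instance Definition _ := SubChoice.on cocycle.
HB.instance Definition _ := [SubChoice_isSubLmodule of cocycle by <:].

Definition cohomologous (x y : cocycle) : Prop :=
  exists z : C (i - 1), val x - val y = cdiff C (i - 1) i z.

Lemma cohomologous_refl x : cohomologous x x.
Proof. by exists 0; rewrite subrr linear0. Qed.

Lemma cohomologous_sym x y : cohomologous x y -> cohomologous y x.
Proof. by case=> z e; exists (- z); rewrite linearN -e opprB. Qed.

Lemma cohomologous_trans x y z :
  cohomologous x y -> cohomologous y z -> cohomologous x z.
Proof.
case=> u eu [v ev]; exists (u + v).
by rewrite linearD -eu -ev addrA subrK.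
Qed.

Lemma cohomologous_opp x y : cohomologous x y -> cohomologous (- x) (- y).
Proof.
by case=> z e; exists (- z); rewrite (linearN (cdiff C (i - 1) i)) -e opprB opprK addrC.
Qed.

Lemma cohomologous_add x x' y y' :
  cohomologous x x' -> cohomologous y y' -> cohomologous (x + y) (x' + y').
Proof.
case=> u eu [v ev]; exists (u + v).
by rewrite (linearD (cdiff C (i - 1) i)) -eu -ev /= opprD addrACA.
Qed.

Lemma cohomologous_scale a x y :
  cohomologous x y -> cohomologous (a *: x) (a *: y).
Proof.
case=> z e; exists (a *: z).
by rewrite (linearZZ (cdiff C (i - 1) i)) -e scalerBr.
Qed.

Lemma cohomologous_eq x y : x = y -> cohomologous x y.
Proof. by move->; apply: cohomologous_refl. Qed.

Definition cohomology_premodule : premodule R :=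
  @PreModule R cocycle cohomologous 0 -%R +%R *:%R
    cohomologous_refl cohomologous_sym cohomologous_trans
    cohomologous_opp cohomologous_add cohomologous_scale
    (fun x y z => cohomologous_eq (addrA x y z))
    (fun x y => cohomologous_eq (addrC x y))
    (fun x => cohomologous_eq (add0r x))
    (fun x => cohomologous_eq (addNr x))
    (fun a b x => cohomologous_eq (scalerA a b x))
    (fun x => cohomologous_eq (scale1r x))
    (fun a x y => cohomologous_eq (scalerDr a x y))
    (fun a b x => cohomologous_eq (scalerDl x a b)).

Definition cohomology : lmodType R := quotient cohomology_premodule.

Lemma cohomology_eq0P :
  is_zero cohomology <->
  forall x : C i, cdiff C i (i + 1) x = 0 -> exists z, x = cdiff C (i - 1) i z.
Proof.
split=> [h x /eqP dx|h]; last elim/qpiW=> x.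
  have /qpiP[z] := h (qpi ((exist _ x dx : cocycle) : cohomology_premodule)).
  by rewrite /= subr0 => ->; exists z.
rewrite -qpi0; apply/qpiP.
by have [z e] := h (val x) (eqP (valP x)); exists z; rewrite subr0.
Qed.

End Cohomology.

(* C = 0 in D(R) *)
Definition acyclic (R : pzRingType) (C : complex R) : Prop :=
  forall i, is_zero (cohomology C i).

Section TensorComplex.
Variables (R : comPzRingType) (K N : complex R).

Definition tcpx_comp (ij : int * int) : lmodType R :=
  tensor (K ij.1) (N ij.2).

Definition tcpx_obj (n : int) : lmodType R :=
  dsum tcpx_comp (fun ij => ij.1 + ij.2 == n).

(* d (x (x) y) = d x (x) y + (-1)^i x (x) d y for x of degree i *)
Definition tcpx_diff_fun (n m : int) (t : dprod tcpx_comp) : dprod tcpx_comp :=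
  fun ij => if m == n + 1 then
    tensor_map (cdiff K (ij.1 - 1) ij.1) idfun (t (ij.1 - 1, ij.2)) +
    (- 1) ^+ `|ij.1|%N *:
      tensor_map idfun (cdiff N (ij.2 - 1) ij.2) (t (ij.1, ij.2 - 1))
  else 0.

Lemma tcpx_diff_subproof n m (t : tcpx_obj n) :
  tcpx_diff_fun n m (val t) \in
    dsum_pred (V := tcpx_comp) (fun ij => ij.1 + ij.2 == m).
Proof.
apply/asboolP; rewrite /tcpx_diff_fun; have [->|_] := eqVneq m (n + 1); last first.
  split=> //; rewrite (_ : [set _ | _] = set0) //.
  by apply/seteqP; split=> ij /= nz //; case: (nz erefl).
split=> [[i j] /= ij|].
  rewrite !(dsum_out t) ?linear0 ?scaler0 ?addr0 //=.
    by apply: contra ij => /eqP <-; rewrite addrA subrK.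
  by apply: contra ij => /eqP <-; rewrite addrAC subrK.
have fin := dsum_fin t.
apply: (@sub_finite_set _ _
  ([set (ij.1 + 1, ij.2) | ij in [set ij | val t ij <> 0]] `|`
   [set (ij.1, ij.2 + 1) | ij in [set ij | val t ij <> 0]])).
  move=> [i j] /= nz.
  have [e1|] := pselect (val t (i - 1, j) = 0); last first.
    by move=> ?; left; exists (i - 1, j) => //=; rewrite subrK.
  have [e2|] := pselect (val t (i, j - 1) = 0); last first.
    by move=> ?; right; exists (i, j - 1) => //=; rewrite subrK.
  by exfalso; apply: nz; rewrite e1 e2 !linear0 addr0.
by rewrite finite_setU; split; apply: finite_image.
Qed.

Definition tcpx_diff n m (t : tcpx_obj n) : tcpx_obj m :=
  exist _ (tcpx_diff_fun n m (val t)) (tcpx_diff_subproof m t).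

Lemma tcpx_diff_linear n m : linear (@tcpx_diff n m).
Proof.
move=> a s t; apply: dsum_eqP => -[i j] /=.
rewrite /GRing.add /= /dprod_add /GRing.scale /= /dprod_scale /tcpx_diff_fun /=.
case: ifP => _; last by rewrite scaler0 addr0.
rewrite !linearP !scalerDr !scalerA addrACA; congr (_ + _ + (_ + _)).
Qed.

HB.instance Definition _ n m :=
  GRing.isLinear.Build R (tcpx_obj n) (tcpx_obj m) _ (@tcpx_diff n m)
    (@tcpx_diff_linear n m).

Lemma tcpx_diff_shape n m (t : tcpx_obj n) : m != n + 1 -> tcpx_diff m t = 0.
Proof.
by move=> /negPf nm; apply: dsum_eqP => ij; rewrite /= /tcpx_diff_fun nm.
Qed.

Lemma tcpx_diffK n m k (t : tcpx_obj n) : tcpx_diff k (tcpx_diff m t) = 0.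
Proof.
apply: dsum_eqP => -[i j] /=; rewrite /tcpx_diff_fun /=.
case: ifP => // _; case: ifP => _; last by rewrite !linear0 ?scaler0 ?addr0.
rewrite !(linearD (tensor_map _ _)) !(linearZZ (tensor_map _ _)) /=.
rewrite (tensor_map_comp (h := \0) (l := idfun)) //; last first.
  by move=> x /=; rewrite cdiffK.
rewrite tensor_map0l add0r [X in _ *: X + _ *: _](tensor_map_comp
  (h := cdiff K (i - 1) i) (l := cdiff N (j - 1) j)) //.
rewrite (tensor_map_comp (h := cdiff K (i - 1) i) (l := cdiff N (j - 1) j)) //.
rewrite (tensor_map_comp (h := idfun) (l := \0)) //; last first.
  by move=> x /=; rewrite cdiffK.
rewrite tensor_map0r scaler0 addr0.
rewrite -scalerDl.
have -> : (- 1) ^+ `|i - 1|%N + (- 1) ^+ `|i|%N = 0 :> R.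
  have par : odd `|i - 1|%N = ~~ odd `|i|%N by lia.
  by rewrite -signr_odd par -[X in _ + X]signr_odd; case: odd;
    rewrite ?expr0 ?expr1 ?addrN ?addNr.
by rewrite scale0r.
Qed.

Definition tensor_complex : complex R :=
  @Complex R tcpx_obj (fun n m => @tcpx_diff n m)
    (fun n m => @tcpx_diff_shape n m) (fun n m k => @tcpx_diffK n m k).

End TensorComplex.

Section Support.
Variable R : comPzRingType.

(* The library's [prime_idealr] is restricted to non-trivial rings.              *)
Record prime_ideal := PrimeIdeal {
  prime_pred : R -> bool;
  prime_0 : 0 \in prime_pred;
  prime_D : forall a b, a \in prime_pred -> b \in prime_pred ->
    a + b \in prime_pred;
  prime_M : forall a b, b \in prime_pred -> a * b \in prime_pred;
  prime_proper : 1 \notin prime_pred;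
  prime_prime : forall a b, a * b \in prime_pred ->
    a \in prime_pred \/ b \in prime_pred }.

Definition prime_mem (p : prime_ideal) : {pred R} := prime_pred p.
Coercion prime_mem : prime_ideal >-> pred_sort.

Definition spec_dcc : Prop :=
  forall p : nat -> prime_ideal,
    (forall n, {subset p n.+1 <= p n}) ->
    exists N, forall n, (N <= n)%N -> p n =i p N.

Definition prime_compl (p : prime_ideal) : {pred R} := fun a => a \notin p.

Lemma prime_compl_mulr_closed p : mulr_closed (prime_compl p).
Proof.
split=> [|a b]; first exact: prime_proper.
by rewrite !unfold_in => ap bp; apply/negP=> /prime_prime[]; apply/negP.
Qed.

HB.instance Definition _ p :=
  GRing.isMulClosed.Build R (prime_compl p) (prime_compl_mulr_closed p).

Definition powers (x : R) : {pred R} := fun a => `[< exists n, a = x ^+ n >].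

Lemma powers_mulr_closed x : mulr_closed (powers x).
Proof.
split=> [|_ _ /asboolP[m ->] /asboolP[n ->]]; apply/asboolP.
  by exists 0%N; rewrite expr0.
by exists (m + n)%N; rewrite exprD.
Qed.

HB.instance Definition _ x :=
  GRing.isMulClosed.Build R (powers x) (powers_mulr_closed x).

Section Localize.
Variables (S : mulrClosed R) (M : complex R).

Definition lcpx_obj (i : int) : lmodType R := localization S (M i).

Definition lcpx_diff (i j : int) : {linear lcpx_obj i -> lcpx_obj j} :=
  loc_map S (cdiff M i j).

Lemma lcpx_diff_shape i j x : j != i + 1 -> lcpx_diff i j x = 0.
Proof.
move=> ij; elim/qpiW: x => -[v s].
rewrite [LHS]loc_map_frac cdiff_shape //; apply/qpiP.
by exists 1; rewrite ?rpred1 //= !scaler0.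
Qed.

Lemma lcpx_diffK i j k x : lcpx_diff j k (lcpx_diff i j x) = 0.
Proof.
elim/qpiW: x => -[v s].
rewrite -[qpi _]/(frac v s) /lcpx_diff /= !loc_map_frac cdiffK; apply/qpiP.
by exists 1; rewrite ?rpred1 //= !scaler0.
Qed.

Definition loc_complex : complex R := Complex lcpx_diff_shape lcpx_diffK.

End Localize.

Definition zero_module : lmodType R := 'rV[R]_0.

(* V in degree 0 and W in degree 1 *)
Section TwoTerm.
Variables (V W : lmodType R) (f : {linear V -> W}).

Definition two_term_obj (i : int) : lmodType R :=
  match i with Posz 0 => V | Posz 1 => W | _ => zero_module end.

Definition two_term_diff (i j : int) :
    {linear two_term_obj i -> two_term_obj j} :=
  match i, j with
  | Posz 0, Posz 1 => f
  | _, _ => \0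
  end.

Lemma two_term_shape i j x : j != i + 1 -> two_term_diff i j x = 0.
Proof. by move: i j x => [[|[|i]]|i] [[|[|j]]|j]. Qed.

Lemma two_termK i j k x : two_term_diff j k (two_term_diff i j x) = 0.
Proof.
by move: i j k x => [[|[|i]]|i] [[|[|j]]|j] [[|[|k]]|k] x //=; rewrite linear0.
Qed.

Definition two_term : complex R := Complex two_term_shape two_termK.

End TwoTerm.

(* R, in degree 0 *)
Definition unit_obj (i : int) : lmodType R :=
  match i with Posz 0 => R^o | _ => zero_module end.

Definition unit_diff (i j : int) : {linear unit_obj i -> unit_obj j} := \0.

Definition unit_complex : complex R :=
  @Complex R unit_obj unit_diff (fun _ _ _ _ => erefl) (fun _ _ _ _ => erefl).

(* R -> R_x *)
Definition loc_can_complex (x : R) : complex R :=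
  two_term (loc_can (powers x) : {linear R^o -> localization (powers x) R^o}).

(* Right-nested tensor product, ending with the unit [R] for the empty         *)
(* sequence.                                                                    *)
Definition K_infty (xs : seq R) : complex R :=
  foldr (fun x K => tensor_complex (loc_can_complex x) K) unit_complex xs.

Definition HK_infty (xs : seq R) (N : complex R) (i : int) : lmodType R :=
  cohomology (tensor_complex (K_infty xs) N) i.

Definition supp (M : complex R) : set prime_ideal :=
  [set p : prime_ideal | forall xs : seq R, {subset xs <= p} ->
     exists i : int, ~ is_zero (HK_infty xs (loc_complex (prime_compl p) M) i)].

End Support.

(* Main.v *)
(* Write T_x(D) for the fibre of D -> D_x, so that tensoring a complex D with   *)
(* R -> R_x gives T_x(D).  The argument rests on one property of a complex D    *)
(* and a set Y of ring elements: H^j(D)_y = 0 for all j < i and y in Y, and     *)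
(* some nonzero class of H^i(D) dies in H^i(D)_y for every y in Y.  For x in Y  *)
(* this property passes from D to T_x(D), by the long exact sequence of         *)
(* 0 -> D_x[-1] -> T_x(D) -> D -> 0; hence it passes from N to K_infty(xs : N), *)
(* whose i-th cohomology is therefore nonzero, for all sequences xs in Y.       *)
(* It remains to find a prime p such that N = M_p has the property with Y = p.  *)
(* If H^i(M) is the lowest nonzero cohomology, take p minimal over the          *)
(* annihilator of a nonzero class.  If the primes satisfy the descending chain  *)
(* condition, take p minimal with M_p not acyclic: then (M_p)_y is acyclic for  *)
(* every y in p, as its localizations at primes are the M_q with q strictly     *)
(* inside p.                                                                    *)

(* The property in question is [torsion_bottom]. A class of H^i(D) lifts to T_x(D) when its image in
   H^i(D)_x vanishes, which torsion at x provides; the lift is again torsion because H^(i-1)(D)_y =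
   0 for y in Y. This is [torsion_bottom_extension], iterated in [torsion_bottom_K_infty]. The
   sequence 0 -> D_x[-1] -> T_x(D) -> D -> 0 is carried as a [local_extension]: it is split in every
   degree, so it survives tensoring with any complex ([local_extension_tensor]), and the long exact
   sequence is replaced by explicit cocycles. Primes come from [boundary_prime], applied to the
   ideal of those a for which a multiple a v of a cocycle v is a boundary; [supp_bounded_below] and
   [supp_dcc] then establish [torsion_bottom] over M_p. The converse, [acyclic_supp0], only tests
   the empty sequence. *)
From HB Require Import structures.
From mathcomp Require Import all_boot all_order all_algebra.
From mathcomp Require Import zify ring.
From mathcomp Require Import boolp classical_sets functions cardinality.
Require Import Defs.

Set Implicit Arguments.
Unset Strict Implicit.
Unset Printing Implicit Defensive.

Import Order.TTheory GRing.Theory Num.Theory.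
Local Open Scope ring_scope.
Local Open Scope classical_set_scope.

(** * Primes avoiding a multiplicative set *)

Section PrimeAvoiding.
Variables (R : comPzRingType) (I S0 : set R).
Hypothesis I0 : I 0.
Hypothesis ID : forall a b, I a -> I b -> I (a + b).
Hypothesis IM : forall a b, I b -> I (a * b).
Hypothesis S01 : S0 1.
Hypothesis S0M : forall a b, S0 a -> S0 b -> S0 (a * b).
Hypothesis S0I : forall a, S0 a -> ~ I a.

Lemma maximal_multiplicative_set : exists T : set R,
  [/\ S0 `<=` T, forall a b, T a -> T b -> T (a * b), forall a, T a -> ~ I a &
      forall a, ~ T a -> exists t k, T t /\ I (t * a ^+ k)].
Proof.
(* The union with [S0] is built into [P] so that the empty chain, whose union is empty, also
   satisfies it. *)
pose P (A : set R) := (forall a b, (A `|` S0) a -> (A `|` S0) b ->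
  (A `|` S0) (a * b)) /\ (forall a, (A `|` S0) a -> ~ I a).
have [|A [[AM AI] Amax]] := @Zorn_bigcup R P.
  move=> F FP Ftot; split=> [a b [[X FX Xa]|Sa] [[Y FY Yb]|Sb]|a [[X FX Xa]|]].
  - have [Z [FZ Za Zb]] : exists Z, [/\ F Z, Z a & Z b].
      by have [XY|YX] := Ftot _ _ FX FY; [exists Y|exists X]; split; auto.
    by have [] := (FP _ FZ).1 a b (or_introl Za) (or_introl Zb);
      [left; exists Z | right].
  - by have [] := (FP _ FX).1 a b (or_introl Xa) (or_intror Sb);
      [left; exists X | right].
  - by have [] := (FP _ FY).1 a b (or_intror Sa) (or_introl Yb);
      [left; exists Y | right].
  - by right; apply: S0M.
  - by apply: (FP _ FX).2; left.
  - exact: S0I.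
pose T := A `|` S0.
have T1 : T 1 by right.
exists T; split=> // [a|a Ta]; first by right.
(* [B] is the multiplicative set generated by [T] and [a]; were it disjoint from [I], it would
   contradict maximality. *)
pose B := [set b | exists t k, T t /\ b = t * a ^+ k].
have TB : T `<=` B by move=> t Tt; exists t, 0%N; rewrite expr0 mulr1.
have BS0 b : (B `|` S0) b -> B b by case=> // Sb; apply: TB; right.
apply: contrapT => nI; apply: (Amax B).
  split=> [t At|/(_ a) BA]; first by apply: TB; left.
  by apply: Ta; left; apply: BA; exists 1, 1%N; rewrite expr1 mul1r.
split=> [b c /BS0[t [k [Tt ->]]] /BS0[u [l [Tu ->]]]|b /BS0[t [k [Tt ->]]] It].
  left; exists (t * u), (k + l)%N; split; first exact: AM.
  by rewrite exprD; ring.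
by apply: nI; exists t, k.
Qed.

(* The complement of a maximal multiplicative set disjoint from [I] is a       *)
(* minimal prime over [I]; the last clause expresses this minimality.          *)
Lemma prime_avoiding : exists p : prime_ideal R,
  [/\ forall a, I a -> a \in p, forall a, S0 a -> a \notin p &
      forall a, a \in p -> exists s k, s \notin p /\ I (s * a ^+ k)].
Proof.
have [T [ST TM TI Tmax]] := maximal_multiplicative_set.
have memp a : (a \in (fun a => `[< ~ T a >])) = `[< ~ T a >] by [].
have tor t k a : T t -> I (t * a ^+ k) -> ~ T a.
  move=> Tt It Ta; apply: (TI _ _ It); apply: (TM) => //.
  by elim: {It} k => [|k IH]; rewrite ?expr0 ?exprS; [apply: ST|apply: TM].
have p0 : 0 \in (fun a => `[< ~ T a >]).
  by apply/asboolP => /TI.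
(* In the expansion of (a + b)^(k + l) every term is divisible by a^k or by b^l. *)
have pD a b : a \in (fun a => `[< ~ T a >]) -> b \in (fun a => `[< ~ T a >]) ->
    a + b \in (fun a => `[< ~ T a >]).
  move=> /asboolP/Tmax[t [k [Tt It]]] /asboolP/Tmax[u [l [Tu Iu]]].
  apply/asboolP/(@tor (t * u) (k + l)); first exact: TM.
  rewrite exprDn mulr_sumr; apply: big_ind => // i _.
  have [lk|kl] := leqP l i.
    rewrite -(subnK lk) exprD -mulr_natr.
    set c := a ^+ _; set n := _%:R.
    have -> : t * u * (c * (b ^+ (i - l) * b ^+ l) * n) =
      t * c * n * b ^+ (i - l) * (u * b ^+ l) by ring.
    exact: IM.
  have kli : (k <= k + l - i)%N by lia.
  rewrite -(subnK kli) exprD -mulr_natr.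
  set c := b ^+ _; set n := _%:R; set d := a ^+ (_ - k).
  have -> : t * u * (d * a ^+ k * c * n) = u * c * n * d * (t * a ^+ k) by ring.
  exact: IM.
have pM a b : b \in (fun a => `[< ~ T a >]) -> a * b \in (fun a => `[< ~ T a >]).
  move=> /asboolP/Tmax[t [k [Tt It]]]; apply/asboolP/(@tor t k) => //.
  by rewrite exprMn mulrCA; apply: IM.
have p1 : 1 \notin (fun a => `[< ~ T a >]) by apply/asboolPn => /(_ (ST _ S01)).
have pp a b : a * b \in (fun a => `[< ~ T a >]) ->
    a \in (fun a => `[< ~ T a >]) \/ b \in (fun a => `[< ~ T a >]).
  move=> /asboolP Tab; rewrite !memp.
  have [Ta|Ta] := pselect (T a); last by left; apply/asboolP.
  by right; apply/asboolP => Tb; apply: Tab; apply: TM.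
exists (PrimeIdeal p0 pD pM p1 pp); split=> a.
- by move=> Ia; apply/asboolP => /TI.
- by move=> /ST Ta; apply/asboolPn; apply.
- move=> /asboolP/Tmax[s [k [Ts Is]]]; exists s, k; split=> //.
  by apply/asboolPn; apply.
Qed.
End PrimeAvoiding.

(** * Localization and tensor products of modules *)

Section LocalizedFractions.
Variables (R : comPzRingType) (S : mulrClosed R).

Lemma localization_ind (V : lmodType R) (P : localization S V -> Prop) :
  (forall v s, P (frac v s)) -> forall q, P q.
Proof. by move=> h; elim/qpiW=> -[v s]; apply: h. Qed.

Lemma fracE (V : lmodType R) (v w : V) (s t : denom S) :
  frac v s = frac w t <-> exists2 u, u \in S & u *: (sval t *: v) = u *: (sval s *: w).
Proof. exact: qpiP. Qed.

Lemma frac_eq0 (V : lmodType R) (v : V) (s : denom S) :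
  frac v s = 0 <-> exists2 u, u \in S & u *: v = 0.
Proof.
rewrite -[0]/(frac 0 (denom1 S)) fracE /=; split=> -[u uS].
  by rewrite !scaler0 scale1r; exists u.
by exists u => //; rewrite !scaler0 scale1r.
Qed.

Lemma scale_frac (V : lmodType R) (a : R) (v : V) (s : denom S) :
  a *: frac v s = frac (a *: v) s.
Proof. by rewrite /frac -qpiZ. Qed.

Lemma scale_denom_frac (V : lmodType R) (v : V) (s : denom S) :
  sval s *: frac v s = loc_can S v.
Proof.
rewrite scale_frac; apply/fracE; exists 1; rewrite ?rpred1 //=.
by rewrite !scale1r.
Qed.

Lemma denom_scale_inj (V : lmodType R) (s : R) : s \in S ->
  injective (fun q : localization S V => s *: q).
Proof.
move=> sS q r /eqP; rewrite -subr_eq0 -scalerBr => /eqP e; apply/eqP.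
rewrite -subr_eq0; apply/eqP; move: (q - r) e => {q r}.
elim/localization_ind => v t; rewrite scale_frac => /frac_eq0[u uS e].
by apply/frac_eq0; exists (u * s); rewrite ?rpredM // -scalerA.
Qed.

Lemma denom_divisible (V : lmodType R) (s : R) (q : localization S V) :
  s \in S -> exists r, s *: r = q.
Proof.
move=> sS; elim/localization_ind: q => v t.
exists (frac v (denomM (exist _ s sS) t)); rewrite scale_frac.
apply/fracE; exists 1; rewrite ?rpred1 //= !scale1r !scalerA.
by congr (_ *: _); ring.
Qed.
End LocalizedFractions.

(** Elements of a direct sum have finite support, so exponents found component by component can be
    replaced by a single one. *)
Lemma finite_set_exponent (T : choiceType) (A : set T) (P : T -> nat -> Prop) :
  finite_set A -> (forall a, exists k, P a k) ->
  (forall a k l, (k <= l)%N -> P a k -> P a l) -> exists K, forall a, A a -> P a K.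
Proof.
move=> /finite_seqP[s ->] /choice[k kP] Pmono.
exists (\sum_(a <- s) k a)%N => a /= a_s.
by apply: Pmono (kP a); rewrite (big_rem a) //= leq_addr.
Qed.

Section TensorLift.
Variables (R : comPzRingType) (V W U : lmodType R) (b : V -> W -> U).
Hypothesis bl : forall w, linear (b^~ w).
Hypothesis br : forall v, linear (b v).

Definition tens_lift_seq (s : tens_premodule V W) : U := \sum_(x <- s) b x.1 x.2.

Lemma tens_lift_seq_eq s t : pm_eq s t -> tens_lift_seq s = tens_lift_seq t.
Proof.
have bD w v v' : b (v + v') w = b v w + b v' w.
  by rewrite -[v in v + _]scale1r bl scale1r.
have b0 w : b 0 w = 0 by apply: (addrI (b 0 w)); rewrite -bD !addr0.
have bD' v w w' : b v (w + w') = b v w + b v w'.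
  by rewrite -[w in w + _]scale1r br scale1r.
have b0' w : b w 0 = 0 by apply: (addrI (b w 0)); rewrite -bD' !addr0.
rewrite /tens_lift_seq; elim=> {s t} //.
- by move=> s t u _ -> _ ->.
- by move=> s s' t t' _ e _ e'; rewrite !big_cat /= e e'.
- by move=> s t; rewrite !big_cat /= addrC.
- by move=> w; rewrite big_seq1 big_nil b0.
- by move=> v v' w; rewrite !big_cons !big_nil !addr0 bD.
- by move=> v w w'; rewrite !big_cons !big_nil !addr0 bD'.
- move=> a v w; rewrite !big_seq1 /=.
  by rewrite -[a *: v]addr0 bl b0 addr0 -[a *: w]addr0 br b0' addr0.
Qed.

Definition tens_lift (q : tensor V W) : U := tens_lift_seq (repr q).

Lemma tens_lift_qpi s : tens_lift (qpi s) = tens_lift_seq s.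
Proof. exact/tens_lift_seq_eq/repr_qpi. Qed.

Lemma tens_lift_linear : linear tens_lift.
Proof.
move=> a; elim/qpiW=> s; elim/qpiW=> t.
rewrite -qpiZ -qpiD !tens_lift_qpi /tens_lift_seq big_cat /= /tens_scale big_map.
congr (_ + _); rewrite scaler_sumr; apply: eq_bigr => x _ /=.
have b0 : b 0 x.2 = 0.
  apply: (addrI (b 0 x.2)); rewrite addr0.
  by move: (bl x.2 1 0 0); rewrite /= scaler0 addr0 scale1r => /esym.
by rewrite -[a *: x.1]addr0 bl b0 addr0.
Qed.

Lemma bilinear_lift : exists f : {linear tensor V W -> U},
  forall v w, f (pure v w) = b v w.
Proof.
exists (HB.pack_for {linear tensor V W -> U} tens_lift
  (GRing.isLinear.Build R (tensor V W) U _ tens_lift tens_lift_linear)) => v w.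
by rewrite /= tens_lift_qpi /tens_lift_seq big_seq1.
Qed.
End TensorLift.

Lemma pure_linearl (R : comPzRingType) (V W : lmodType R) (w : W) :
  linear (fun v : V => pure v w).
Proof.
move=> a v v'; rewrite /pure -qpiZ -qpiD; apply/qpiP.
exact: tens_Dl.
Qed.

Lemma pure_linearr (R : comPzRingType) (V W : lmodType R) (v : V) :
  linear (fun w : W => pure v w).
Proof.
move=> a w w'; rewrite /pure -qpiZ -qpiD; apply/qpiP.
apply: tens_trans (tens_Dr _ _ _) _.
apply: (@tens_cat _ _ _ [:: _] [:: _] [:: _] [:: _]); last exact: tens_refl.
exact/tens_sym/tens_Z.
Qed.

(** A named function of the first factor, to which a linear structure can be attached. *)
Definition purel (R : comPzRingType) (V W : lmodType R) (w : W) (v : V) := pure v w.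

HB.instance Definition _ (R : comPzRingType) (V W : lmodType R) (w : W) :=
  GRing.isLinear.Build R V (tensor V W) _ (purel w) (pure_linearl w).

Section TensorMapTheory.
Variables (R : comPzRingType) (V V' W W' : lmodType R).
Variables (f : {linear V -> V'}) (g : {linear W -> W'}).

Lemma tensor_mapD t u : tensor_map f g (t + u) = tensor_map f g t + tensor_map f g u.
Proof. exact: linearD. Qed.

Lemma tensor_mapZ a t : tensor_map f g (a *: t) = a *: tensor_map f g t.
Proof. exact: linearZZ. Qed.

Lemma tensor_map0 : tensor_map f g 0 = 0.
Proof. exact: linear0. Qed.
End TensorMapTheory.

Lemma powersX (R : comPzRingType) (x : R) n : x ^+ n \in powers x.
Proof. by apply/asboolP; exists n. Qed.

Section LocalizationMap.
Variables (R : comPzRingType) (S : mulrClosed R).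

Lemma frac_linear (V : lmodType R) (s : denom S) : linear (fun v : V => frac v s).
Proof.
move=> a v w; apply: (denom_scale_inj (valP s)) => /=.
by rewrite scalerDr scalerA mulrC -scalerA !scale_denom_frac linearP.
Qed.

Lemma loc_map_can (V W : lmodType R) (f : {linear V -> W}) v :
  loc_map S f (loc_can S v) = loc_can S (f v).
Proof. exact: loc_map_frac. Qed.

Lemma loc_can_eq0 (V : lmodType R) (v : V) :
  loc_can S v = 0 <-> exists2 u, u \in S & u *: v = 0.
Proof. exact: frac_eq0. Qed.
End LocalizationMap.

Section LocSplit.
Variables (R : comPzRingType) (x : R).

(* [c] identifies the kernel of the split surjection [p] with the localization *)
(* V_x; this is formulated elementwise.                                        *)
Record loc_split (V X D : lmodType R) (p : {linear X -> D}) (s : {linear D -> X})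
    (c : {linear V -> X}) : Prop := LocSplit {
  ls_section : forall t, p (s t) = t;
  ls_pc : forall v, p (c v) = 0;
  ls_inj : forall e, p e = 0 -> x *: e = 0 -> e = 0;
  ls_div : forall e, p e = 0 -> exists2 e', p e' = 0 & x *: e' = e;
  ls_surj : forall e, p e = 0 -> exists k v, x ^+ k *: e = c v;
  ls_ker : forall v, c v = 0 -> exists k, x ^+ k *: v = 0 }.

Section Theory.
Variables (V X D : lmodType R) (p : {linear X -> D}) (s : {linear D -> X}).
Variables (c : {linear V -> X}) (sp : loc_split p s c).

Lemma ls_inj_pow k e : p e = 0 -> x ^+ k *: e = 0 -> e = 0.
Proof.
elim: k e => [|k IH] e pe; first by rewrite expr0 scale1r.
rewrite exprS -scalerA => /(ls_inj sp) h; apply: IH => //; apply: h.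
by rewrite linearZ /= pe scaler0.
Qed.

Lemma ls_div_pow k e : p e = 0 -> exists2 e', p e' = 0 & x ^+ k *: e' = e.
Proof.
elim: k e => [|k IH] e pe; first by exists e; rewrite // expr0 scale1r.
have [e' pe' <-] := ls_div sp pe; have [f pf <-] := IH _ pe'.
by exists f; rewrite // exprS scalerA.
Qed.

Lemma ls_defect t : p (t - s (p t)) = 0.
Proof. by rewrite linearB /= (ls_section sp) subrr. Qed.

(* x^-1 on the kernel of [p], extended by 0 on the image of [s]                *)
Lemma ls_inverse : exists xi : {linear X -> X},
  (forall t, p (xi t) = 0) /\ (forall t, x *: xi t = t - s (p t)).
Proof.
have /choice[xi xiP] : forall t, exists e, p e = 0 /\ x *: e = t - s (p t).
  by move=> t; have [e pe eE] := ls_div sp (ls_defect t); exists e.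
have xi_lin : linear xi.
  move=> a t u; apply/eqP; rewrite -subr_eq0; apply/eqP; apply: (ls_inj sp).
    by rewrite linearB linearP /= !(proj1 (xiP _)) scaler0 addr0 subrr.
  rewrite scalerBr scalerDr scalerA mulrC -scalerA !(proj2 (xiP _)).
  rewrite (linearP p) (linearP s) /= scalerBr opprD addrACA.
  by rewrite subrr.
pose xiL : {linear X -> X} := HB.pack xi (GRing.isLinear.Build R X X _ xi xi_lin).
by exists xiL; split=> t; have [] := xiP t.
Qed.

(** The projection t - s (p t) onto the kernel of [p], followed by the identification of that kernel
    with V_x. It serves to detect the kernel of [c] after tensoring. *)
Lemma ls_retraction : exists rho : {linear X -> localization (powers x) V},
  forall v, rho (c v) = loc_can (powers x) v.
Proof.
pose can v := loc_can (powers x) v : localization (powers x) V.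
have canZ a v : a *: can v = can (a *: v) by rewrite /can (linearZZ (loc_can _)).
have canD v w : can (v + w) = can v + can w by rewrite /can linearD.
(* The graph of the retraction: q is the fraction v / x^k. *)
pose P t q := exists k v, x ^+ k *: (t - s (p t)) = c v /\ x ^+ k *: q = can v.
have Puniq t q r : P t q -> P t r -> q = r.
  move=> [k [v [tv qv]]] [l [w [tw rw]]].
  have : c (x ^+ l *: v - x ^+ k *: w) = 0.
    by rewrite (linearB c) !(linearZZ c) /= -tv -tw !scalerA mulrC subrr.
  case/(ls_ker sp) => n /eqP; rewrite scalerBr subr_eq0 => /eqP e.
  apply: (denom_scale_inj (powersX x (n + l + k))) => /=.
  have -> : x ^+ (n + l + k) *: q = x ^+ n *: (x ^+ l *: can v).
    by rewrite -qv !scalerA !exprD.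
  have -> : x ^+ (n + l + k) *: r = x ^+ n *: (x ^+ k *: can w).
    by rewrite -rw !scalerA !exprD mulrAC.
  by rewrite !canZ e.
have Plin a t t' q q' : P t q -> P t' q' -> P (a *: t + t') (a *: q + q').
  move=> [k [v [tv qv]]] [l [w [tw rw]]].
  exists (k + l)%N, (a * x ^+ l *: v + x ^+ k *: w); split.
    rewrite (linearP p) (linearP s) (linearD c) !(linearZZ c) /= -tv -tw.
    rewrite opprD addrACA -scalerBr scalerDr !scalerA.
    by congr (_ *: _ + _ *: _); rewrite exprD; ring.
  rewrite canD -!canZ -qv -rw scalerDr !scalerA.
  by congr (_ *: _ + _ *: _); rewrite exprD; ring.
have /choice[rho rhoP] : forall t, exists q, P t q.
  move=> t; have [k [v kv]] := ls_surj sp (ls_defect t).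
  by have [q qE] := denom_divisible (can v) (powersX x k); exists q, k, v.
have rho_lin : linear rho by move=> a t u; apply: Puniq (rhoP _) (Plin _ _ _ _ _ _ _).
pose rhoL : {linear X -> localization (powers x) V} :=
  HB.pack rho (GRing.isLinear.Build R X _ _ rho rho_lin).
exists rhoL => v; apply: Puniq (rhoP _) _.
exists 0%N, v; rewrite expr0 !scale1r; split=> //.
by rewrite (ls_pc sp) linear0 subr0.
Qed.

(** No flatness of W enters: the section, the inverse of x on the kernel and the retraction onto V_x
    are linear maps, and tensoring preserves the identities between them. *)
Lemma loc_split_tensor (W : lmodType R) :
  loc_split (tensor_map p (idfun : {linear W -> W})) (tensor_map s idfun)
    (tensor_map c idfun).
Proof.
have [xi [pxi xiE]] := ls_inverse.
have Txi (t : tensor X W) :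
    x *: tensor_map xi idfun t = t - tensor_map s idfun (tensor_map p idfun t).
  elim/tensor_ind: t => [|v w t IH]; first by rewrite !tensor_map0 ?scaler0 ?subr0 ?addr0.
  rewrite !tensor_mapD scalerDr IH !tensor_map_pure opprD addrACA.
  by rewrite -!/(purel w _) -linearZ /= xiE linearB.
have Tpxi (t : tensor X W) : tensor_map p idfun (tensor_map xi idfun t) = 0.
  elim/tensor_ind: t => [|v w t IH]; first by rewrite !tensor_map0.
  by rewrite !tensor_mapD IH !tensor_map_pure pxi pure0l addr0.
split=> /=.
- move=> t; elim/tensor_ind: t => [|v w t IH]; first by rewrite !tensor_map0.
  by rewrite !tensor_mapD IH !tensor_map_pure (ls_section sp).
- move=> t; elim/tensor_ind: t => [|v w t IH]; first by rewrite !tensor_map0.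
  by rewrite !tensor_mapD IH !tensor_map_pure (ls_pc sp) pure0l addr0.
- move=> e pe xe; have := Txi e; rewrite pe tensor_map0 subr0 => <-.
  by rewrite -tensor_mapZ xe tensor_map0.
- move=> e pe; exists (tensor_map xi idfun e); first exact: Tpxi.
  by rewrite Txi pe tensor_map0 subr0.
- move=> e pe.
  (* In this form the claim makes sense for every tensor, so that induction on tensors applies; the
     terms of a sum in the kernel need not lie in it. *)
  have -> : e = e - tensor_map s idfun (tensor_map p idfun e).
    by rewrite pe tensor_map0 subr0.
  elim/tensor_ind: {pe} e => [|v w t [k [u ku]]].
    by exists 0%N, 0; rewrite !tensor_map0 ?subr0 ?scaler0.
  have [l [v' lv']] := ls_surj sp (ls_defect v).
  exists (k + l)%N, (x ^+ k *: pure v' w + x ^+ l *: u).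
  rewrite /= !tensor_mapD !tensor_mapZ -ku !tensor_map_pure -lv' opprD addrACA scalerDr.
  congr (_ + _); last by rewrite scalerA -exprD addnC.
  by rewrite -!/(purel w _) -linearB linearZZ /= scalerA -exprD.
- have [rho rhoE] := ls_retraction.
  (* The bilinear map behind V_x (x) W -> (V (x) W)_x, precomposed with the retraction; on c v it
     gives (v (x) w) / 1. *)
  pose b (t : X) (w : W) := loc_map (powers x) (purel w) (rho t).
  have bl w : linear (b^~ w) by move=> a t u; rewrite /b !linearP.
  have br t : linear (b t).
    move=> a w w'; rewrite /b; elim/localization_ind: (rho t) => v r.
    rewrite !loc_map_frac /= -frac_linear; congr (frac _ _).
    exact: pure_linearr.
  have [f fE] := bilinear_lift bl br.
  move=> u cu; suff : loc_can (powers x) u = 0.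
    by case/loc_can_eq0 => _ /asboolP[k ->] ku; exists k.
  have <- : f (tensor_map c idfun u) = loc_can (powers x) u.
    elim/tensor_ind: u {cu} => [|v w u IH]; first by rewrite tensor_map0 !linear0.
    by rewrite !linearD /= IH tensor_map_pure fE /b rhoE loc_map_can.
  by rewrite cu linear0.
Qed.
End Theory.
End LocSplit.

(** * Chain maps of tensor products *)

Section DirectSumTheory.
Variables (R : pzRingType) (I : choiceType).

Lemma dsum_mk (V : I -> lmodType R) (P : pred I) (g : forall i, V i) :
  (forall i, ~~ P i -> g i = 0) -> finite_set [set i | g i <> 0] ->
  exists t : dsum V P, forall i, val t i = g i.
Proof.
move=> g0 gfin.
have gP : (g : dprod V) \in dsum_pred (V := V) P by apply/asboolP.
by exists (exist _ (g : dprod V) gP).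
Qed.

Lemma dsum_single (V : I -> lmodType R) (P : pred I) k (v : V k) : P k ->
  exists t : dsum V P, val t k = v /\ forall i, i != k -> val t i = 0.
Proof.
move=> Pk; pose g := dfwith (fun i => 0 : V i) v.
have gout i : i != k -> g i = 0 by rewrite eq_sym => ik; rewrite /g dfwith_out.
have [i Pi||t tE] := @dsum_mk V P g.
- by apply: gout; apply: contraNneq Pi => ->.
- apply: (@sub_finite_set _ _ [set k]) => [i /= gi|]; last exact: finite_set1.
  by apply: contrapT => /eqP /gout.
- by exists t; split=> [|i ik]; rewrite tE; [rewrite /g dfwith_in|apply: gout].
Qed.

Variables (V W : I -> lmodType R) (P : pred I) (h : forall i, {linear V i -> W i}).

Definition dsum_map_fun (t : dprod V) : dprod W := fun i => h i (t i).

Lemma dsum_map_subproof (t : dsum V P) :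
  dsum_map_fun (val t) \in dsum_pred (V := W) P.
Proof.
apply/asboolP; split=> [i Pi|]; first by rewrite /dsum_map_fun dsum_out ?linear0.
apply: sub_finite_set (dsum_fin t) => i /= hi ti.
by apply: hi; rewrite /dsum_map_fun ti linear0.
Qed.

Definition dsum_map (t : dsum V P) : dsum W P := 
  exist _ (dsum_map_fun (val t)) (dsum_map_subproof t).

Lemma dsum_map_linear : linear dsum_map.
Proof. by move=> a s t; apply: dsum_eqP => i; apply: linearP. Qed.

HB.instance Definition _ :=
  GRing.isLinear.Build R (dsum V P) (dsum W P) _ dsum_map dsum_map_linear.

End DirectSumTheory.

Section ChainMaps.
Variable R : comPzRingType.

Definition chain_map (X Y : complex R) (f : forall n, {linear X n -> Y n}) : Prop :=
  forall n m t, f m (cdiff X n m t) = cdiff Y n m (f n t).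

Definition tensor_cmap (X Y N : complex R) (f : forall n, {linear X n -> Y n}) n :
    {linear tensor_complex X N n -> tensor_complex Y N n} :=
  dsum_map (V := tcpx_comp X N) (W := tcpx_comp Y N) (P := fun ij => ij.1 + ij.2 == n)
    (fun ij => tensor_map (f ij.1) (idfun : {linear N ij.2 -> N ij.2})).

Lemma tensor_cmap_chain (X Y N : complex R) (f : forall n, {linear X n -> Y n}) :
  chain_map f -> chain_map (tensor_cmap N f).
Proof.
move=> fd n m t; apply: dsum_eqP => -[i j]; rewrite /= /dsum_map_fun /tcpx_diff_fun /=.
case: ifP => _; last by rewrite tensor_map0.
rewrite tensor_mapD tensor_mapZ.
rewrite (tensor_map_comp (h := f i \o cdiff X (i - 1) i) (l := idfun)) //.
rewrite (tensor_map_comp (h := f i) (l := cdiff N (j - 1) j)) //.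
rewrite (tensor_map_comp (h := f i \o cdiff X (i - 1) i) (l := idfun)) //.
  by rewrite (tensor_map_comp (h := f i) (l := cdiff N (j - 1) j)).
by move=> v /=; rewrite fd.
Qed.

Definition chain_iso (X Y : complex R) (f : forall n, {linear X n -> Y n})
    (g : forall n, {linear Y n -> X n}) : Prop :=
  [/\ chain_map f, forall n, cancel (f n) (g n) & forall n, cancel (g n) (f n)].

Lemma tensor_cmap_cancel (X Y N : complex R) (f : forall n, {linear X n -> Y n})
    (g : forall n, {linear Y n -> X n}) : (forall n, cancel (f n) (g n)) ->
  forall n, cancel (tensor_cmap N f n) (tensor_cmap N g n).
Proof.
move=> fK n t; apply: dsum_eqP => -[i j]; rewrite /= /dsum_map_fun /=.
rewrite (tensor_map_comp (h := idfun) (l := idfun)) //; last first.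
  by move=> v /=; rewrite fK.
elim/tensor_ind: (val t (i, j)) => [|v w u IH]; first by rewrite tensor_map0.
by rewrite tensor_mapD tensor_map_pure IH.
Qed.

Lemma tensor_cmap_iso (X Y N : complex R) (f : forall n, {linear X n -> Y n})
    (g : forall n, {linear Y n -> X n}) : chain_iso f g ->
  chain_iso (tensor_cmap N f) (tensor_cmap N g).
Proof.
by case=> fd fK gK; split; [exact: tensor_cmap_chain | exact: tensor_cmap_cancel |
  exact: tensor_cmap_cancel].
Qed.

Lemma chain_iso_sym (X Y : complex R) (f : forall n, {linear X n -> Y n})
    (g : forall n, {linear Y n -> X n}) : chain_iso f g -> chain_iso g f.
Proof.
by case=> fd fK gK; split=> // n m t; apply: (can_inj (fK m)); rewrite fd !gK.
Qed.

Lemma tensor_zerol (V W : lmodType R) : is_zero V -> is_zero (tensor V W).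
Proof.
move=> V0 t; elim/tensor_ind: t => // v w t ->.
by rewrite (V0 v) pure0l addr0.
Qed.

Lemma is_zero_unit_complex (i : int) : i != 0 -> is_zero (unit_complex R i).
Proof. by move: i => [[|i]|i] //= _ v; apply: thinmx0. Qed.

(** Only the component of bidegree (0, n) is nonzero, and there R (x) V is V, with inverse v -> 1
    (x) v. *)
Lemma tensor_unit_iso (C : complex R) :
  exists f g, @chain_iso (tensor_complex (unit_complex R) C) C f g.
Proof.
have bilin (V : lmodType R) : {f : {linear tensor R^o V -> V} |
    forall (r : R^o) v, f (pure r v) = r *: v}.
  apply/cid/bilinear_lift => [v a r s|r a v w].
    by rewrite scalerDl scalerA.
  by rewrite scalerDr !scalerA mulrC.
pose ut V := sval (bilin V).
have utE V (r : R^o) v : ut V (pure r v) = r *: v by exact: (svalP (bilin V)).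
have utK V t : pure (1 : R^o) (ut V t) = t.
  elim/tensor_ind: t => [|r v t IH]; first by rewrite linear0 pure0r.
  rewrite linearD /= utE -[r *: v]scale1r pure_linearr scale1r IH.
  congr (_ + _); transitivity (pure ((r : R) *: (1 : R^o)) v).
    exact/esym/qpiP/tens_Z.
  by rewrite /GRing.scale /= mulr1.
pose f0 n (t : tensor_complex (unit_complex R) C n) := ut (C n) (val t (0, n)).
have f0_lin n : linear (@f0 n) by move=> a t u; apply: (linearP (ut (C n))).
pose f n := HB.pack_for {linear tensor_complex (unit_complex R) C n -> C n} (@f0 n)
  (GRing.isLinear.Build R _ _ _ (@f0 n) (@f0_lin n)).
have g_ex n : exists g : {linear C n -> tensor_complex (unit_complex R) C n},
    forall v, val (g v) (0, n) = pure (1 : R^o) v /\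
      forall ij, ij != (0, n) -> val (g v) ij = 0.
  have /choice[g gP] : forall v, exists t : tensor_complex (unit_complex R) C n,
      val t (0, n) = pure (1 : R^o) v /\ forall ij, ij != (0, n) -> val t ij = 0.
    move=> v; apply: (dsum_single (V := tcpx_comp (unit_complex R) C)
      (P := fun ij => ij.1 + ij.2 == n) (k := (0, n)) (pure (1 : R^o) v)).
    by rewrite /= add0r.
  have g_lin : linear g.
    move=> a v w; apply: dsum_eqP => ij.
    rewrite -[RHS]/(a *: val (g v) ij + val (g w) ij).
    have [->|ij0] := eqVneq ij (0, n).
      by rewrite !(proj1 (gP _)); apply: pure_linearr.
    by rewrite !(proj2 (gP _)) // scaler0 addr0.
  by exists (HB.pack_for {linear C n -> tensor_complex (unit_complex R) C n} g
    (GRing.isLinear.Build R _ _ _ g g_lin)).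
pose g n := sval (cid (g_ex n)).
have gE n := svalP (cid (g_ex n)).
exists f, g; split=> [n m t|n t|n v].
- have [->|mn] := eqVneq m (n + 1); last by rewrite !cdiff_shape ?linear0.
  rewrite /= /f0 /= /tcpx_diff_fun /= eqxx tensor_map0l add0r expr0.
  rewrite scale1r addrK; elim/tensor_ind: (val t (0, n)) => [|r v u IH].
    by rewrite !linear0.
  by rewrite tensor_mapD !linearD /= IH tensor_map_pure !utE linearZ.
- apply: dsum_eqP => ij; have [->|ij0] := eqVneq ij (0, n).
    by rewrite (proj1 (gE _ _)) utK.
  rewrite (proj2 (gE _ _)) //; case: ij ij0 => i j ij0.
  have [i0|i0] := eqVneq i 0; last first.
    by apply/esym/tensor_zerol/is_zero_unit_complex.
  rewrite dsum_out //= i0 add0r; apply: contraNneq ij0 => <-.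
  by rewrite i0.
- by rewrite /= /f0 (proj1 (gE _ _)) utE scale1r.
Qed.
End ChainMaps.

(** * Tensoring with R -> R_x *)

Lemma tensor_mapBl (R : comPzRingType) (V V' W W' : lmodType R)
    (f g : {linear V -> V'}) (h : {linear W -> W'}) t :
  tensor_map (f \- g) h t = tensor_map f h t - tensor_map g h t.
Proof.
elim/tensor_ind: t => [|v w t IH]; first by rewrite !tensor_map0 subr0.
rewrite !tensor_mapD IH !tensor_map_pure opprD addrACA; congr (_ + _).
by rewrite -!/(purel _ _) -linearB.
Qed.

Lemma dep_choice (T : Type) (U : T -> Type) (P : forall t, U t -> Prop) :
  (forall t, exists u, P t u) -> exists f : forall t, U t, forall t, P t (f t).
Proof. by move=> h; exists (fun t => sval (cid (h t))) => t; apply: svalP. Qed.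

Section LocalExtension.
Variable R : comPzRingType.

(** The failure of the degreewise section to be a chain map, which induces the connecting map of the
    extension. On T_x(D) with its evident section it is the map D -> D_x. *)
Definition defect (X D : complex R) (s : forall n, {linear D n -> X n}) (n m : int) :
    {linear D n -> X m} :=
  (cdiff X n m \o s n) \- (s m \o cdiff D n m).

(* A short exact sequence 0 -> D_x[-1] -> X -> D -> 0 of complexes, split by    *)
(* [s] in each degree; D_x is represented by the kernel of [p], with [defect s] *)
(* as localization map.                                                         *)
Definition local_extension (x : R) (X D : complex R)
    (p : forall n, {linear X n -> D n}) (s : forall n, {linear D n -> X n}) :=
  chain_map p /\
  forall n m : int, m = n + 1 -> loc_split x (p m) (s m) (defect s n m).

(** The signed terms with the differential of N cancel, since [s] acts on the other factor. *)
Lemma val_defect_tensor (X D N : complex R) (s : forall n, {linear D n -> X n})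
    (n m : int) (t : tensor_complex D N n) i j : m = n + 1 ->
  val (defect (tensor_cmap N s) n m t) (i, j) =
  tensor_map (defect s (i - 1) i) idfun (val t (i - 1, j)).
Proof.
move=> ->; rewrite /defect /= /dsum_map_fun /tcpx_diff_fun /= eqxx.
rewrite -[LHS]/(_ - _) /dsum_map_fun /=.
rewrite tensor_mapBl tensor_mapD tensor_mapZ.
rewrite (tensor_map_comp (h := cdiff X (i - 1) i \o s (i - 1)) (l := idfun)) //.
rewrite (tensor_map_comp (h := s i) (l := cdiff N (j - 1) j)) //.
rewrite (tensor_map_comp (h := s i \o cdiff D (i - 1) i) (l := idfun)) //.
rewrite (tensor_map_comp (h := s i) (l := cdiff N (j - 1) j)) //.
by rewrite opprD addrACA subrr addr0.
Qed.

Lemma local_extension_tensor (x : R) (X D N : complex R)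
    (p : forall n, {linear X n -> D n}) (s : forall n, {linear D n -> X n}) :
  local_extension x p s -> local_extension x (tensor_cmap N p) (tensor_cmap N s).
Proof.
case=> pd sp; split=> [|n m mn]; first exact: tensor_cmap_chain.
have S i j : loc_split x (tensor_map (p i) (idfun : {linear N j -> N j}))
    (tensor_map (s i) idfun) (tensor_map (defect s (i - 1) i) idfun).
  by apply/loc_split_tensor/sp; rewrite subrK.
have pE e : tensor_cmap N p m e = 0 ->
    forall i j, tensor_map (p i) idfun (val e (i, j)) = 0.
  by move=> pe i j; have := congr1 (fun t : tensor_complex D N m => val t (i, j)) pe.
split.
- by move=> t; apply: dsum_eqP => -[i j]; apply: (ls_section (S i j)).
- move=> v; apply: dsum_eqP => -[i j].
  rewrite -[LHS]/(tensor_map (p i) idfun (val (defect (tensor_cmap N s) n m v) (i, j))).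
  by rewrite val_defect_tensor // (ls_pc (S i j)).
- move=> e pe xe; apply: dsum_eqP => -[i j]; apply: (ls_inj (S i j)).
    exact: pE.
  by have := congr1 (fun t : tensor_complex X N m => val t (i, j)) xe.
- move=> e pe.
  (* Choosing 0 wherever [e] vanishes keeps the support of the quotient finite; the same device
     recurs below. *)
  have /dep_choice[g gP] : forall ij : int * int, exists f : tcpx_comp X N ij,
      [/\ tensor_map (p ij.1) idfun f = 0, x *: f = val e ij &
        val e ij = 0 -> f = 0].
    case=> i j; have [e0|ne0] := pselect (val e (i, j) = 0).
      by exists 0; rewrite tensor_map0 scaler0 e0.
    by have [f pf fe] := ls_div (S i j) (pE e pe i j); exists f.
  have [ij ijm||e' e'E] := @dsum_mk _ _ (tcpx_comp X N) (fun ij => ij.1 + ij.2 == m) g.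
  + by have [_ _] := gP ij; apply; rewrite dsum_out.
  + apply: sub_finite_set (dsum_fin e) => ij /= gij eij.
    by apply: gij; have [_ _] := gP ij; apply.
  + exists e'; apply: dsum_eqP => ij.
      by rewrite /= /dsum_map_fun e'E; have [] := gP ij.
    by rewrite -[LHS]/(x *: val e' ij) e'E; have [] := gP ij.
- move=> e pe.
  have [||K KP] := @finite_set_exponent _ [set ij | val e ij <> 0] (fun ij k =>
    exists v : tensor (D (ij.1 - 1)) (N ij.2), x ^+ k *: val e ij =
      tensor_map (defect s (ij.1 - 1) ij.1) idfun v) (dsum_fin e).
  + by case=> i j; apply: (ls_surj (S i j)); apply: pE.
  + move=> ij k l kl [v kv]; exists (x ^+ (l - k) *: v).
    by rewrite tensor_mapZ -kv scalerA -exprD subnK.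
  (* Quantifying over k = i + 1 avoids transport along (i - 1) + 1 = i when [g] is used. *)
  have /dep_choice[g gP] : forall ij : int * int, exists u : tcpx_comp D N ij,
      forall k : int, k = ij.1 + 1 ->
        x ^+ K *: val e (k, ij.2) = tensor_map (defect s ij.1 k) idfun u /\
        (val e (k, ij.2) = 0 -> u = 0).
    case=> i j /=; have [e0|ne0] := pselect (val e (i + 1, j) = 0).
      by exists 0 => k ->; rewrite e0 scaler0 tensor_map0.
    have := KP (i + 1, j) ne0; rewrite /= addrK => -[v vE].
    by exists v => k ->.
  have [ij ijn||v vE] := @dsum_mk _ _ (tcpx_comp D N) (fun ij => ij.1 + ij.2 == n) g.
  + have [_] := gP ij _ erefl; apply; rewrite dsum_out //=.
    by rewrite mn addrAC (inj_eq (addIr _)).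
  + apply: (@sub_finite_set _ _ ((fun ij => (ij.1 - 1, ij.2)) @` [set ij | val e ij <> 0])).
      move=> [i j] /= gij; exists (i + 1, j); rewrite /= ?addrK // => eij.
      by apply: gij; have [_] := gP (i, j) _ erefl; apply.
    by apply: finite_image; apply: dsum_fin.
  exists K, v; apply: dsum_eqP => -[i j].
  rewrite val_defect_tensor // vE -[LHS]/(x ^+ K *: val e (i, j)).
  by have [] := gP (i - 1, j) i (esym (subrK _ _)).
- move=> v cv.
  have c0 i j : tensor_map (defect s i (i + 1)) idfun (val v (i, j)) = 0.
    have := congr1 (fun t : tensor_complex X N m => val t (i + 1, j)) cv.
    by rewrite val_defect_tensor // addrK.
  have [||K KP] := @finite_set_exponent _ [set ij | val v ij <> 0] (fun ij k =>
    x ^+ k *: val v ij = 0) (dsum_fin v).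
  + case=> i j; have := loc_split_tensor (sp i _ erefl) (N j).
    by move/ls_ker/(_ _ (c0 i j)).
  + by move=> ij k l kl k0; rewrite -(subnK kl) exprD -scalerA k0 scaler0.
  exists K; apply: dsum_eqP => ij; rewrite -[LHS]/(x ^+ K *: val v ij).
  have [v0|] := pselect (val v ij = 0); last exact: KP.
  by rewrite v0 scaler0.
Qed.
End LocalExtension.

Section Augmentation.
Variables (R : comPzRingType) (x : R).

Definition loc_can_aug (n : int) : {linear loc_can_complex x n -> unit_complex R n} :=
  match n with Posz 0 => idfun | _ => \0 end.

Definition loc_can_coaug (n : int) : {linear unit_complex R n -> loc_can_complex x n} :=
  match n with Posz 0 => idfun | _ => \0 end.

Lemma loc_can_complex_extension : local_extension x loc_can_aug loc_can_coaug.
Proof.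
split=> [[[|n]|n] [[|[|m]]|m] t //=|n m ->].
have zm (v : zero_module R) : v = 0 by apply: thinmx0.
(* The essential case: in degree 1 the kernel is all of R_x, and the defect is R -> R_x. *)
have [->|n0] := eqVneq n 0.
  split=> //=.
  - move=> e _ xe; apply: (denom_scale_inj (powersX x 1)).
    by rewrite /= expr1 scaler0.
  - move=> e _; have [f fe] := denom_divisible e (powersX x 1).
    by exists f; rewrite // -[x]expr1.
  - elim/localization_ind => v [r rP] _; have /asboolP[k rE] := rP.
    exists k, v; rewrite -rE subr0; exact: (scale_denom_frac v (exist _ r rP)).
  - move=> v; rewrite /= subr0 => /loc_can_eq0[_ /asboolP[k ->] kv].
    by exists k.
(* In degree 0 the augmentation is the identity of R, so its kernel is zero. *)
have [->|n1] := eqVneq n (-1).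
  split=> //=.
  - by move=> _; rewrite subr0.
  - by move=> e ->; exists 0; rewrite ?scaler0.
  - by move=> e ->; exists 0%N, 0; rewrite scaler0 subr0.
  - by move=> v _; exists 0%N; apply: zm.
have nz1 : is_zero (loc_can_complex x (n + 1)).
  have n10 : n + 1 != 0 by rewrite addr_eq0.
  have n11 : n + 1 != 1 by rewrite -subr_eq0 addrK.
  by move: (n + 1) n10 n11 => [[|[|k]]|k] //= _ _ v; apply: zm.
have nz2 := is_zero_unit_complex n0 (R := R).
have nz3 : is_zero (unit_complex R (n + 1)).
  by apply: is_zero_unit_complex; rewrite addr_eq0.
split.
- by move=> t; rewrite [RHS]nz3 [LHS]nz3.
- by move=> t; rewrite [RHS]nz3 [LHS]nz3.
- by move=> t; rewrite [t]nz1.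
- by move=> t _; exists 0; rewrite ?linear0 // [t]nz1 scaler0.
- by move=> t _; exists 0%N, 0; rewrite [LHS]nz1 [RHS]nz1.
- by move=> t _; exists 0%N; rewrite [LHS]nz2.
Qed.
End Augmentation.

(** * Torsion cohomology and K_infty *)

Section PowerTorsion.
Variable R : comPzRingType.

Lemma cocycle_next (C : complex R) (i j k : int) (z : C i) :
  k = j -> cdiff C i j z = 0 -> cdiff C i k z = 0.
Proof. by move->. Qed.

Definition power_torsion (Y : set R) (C : complex R) (i : int) (z : C i) : Prop :=
  forall y, Y y -> exists k (u : C (i - 1)), y ^+ k *: z = cdiff C (i - 1) i u.

(* As localization is exact, this says that H^j(C_y) = 0 for y in [Y] and      *)
(* j < i, and that some nonzero class in H^i(C) vanishes in all H^i(C_y).      *)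
Definition torsion_bottom (Y : set R) (C : complex R) (i : int) : Prop :=
  (forall (j : int) (z : C j), j < i -> cdiff C j (j + 1) z = 0 -> power_torsion Y z) /\
  exists w : C i, [/\ cdiff C i (i + 1) w = 0, power_torsion Y w &
    forall u, w <> cdiff C (i - 1) i u].

Lemma torsion_bottom_iso Y (C C' : complex R) f g i :
  @chain_iso R C C' f g -> torsion_bottom Y C i -> torsion_bottom Y C' i.
Proof.
move=> fg; have [gd gK fK] := chain_iso_sym fg; have [fd _ _] := fg.
have tor j (z : C' j) : power_torsion Y (g j z) -> power_torsion Y z.
  move=> gz y /gz[k [u ku]]; exists k, (f _ u).
  by rewrite -fd -ku linearZ /= gK.
case=> [low [w [dw tw nw]]]; split=> [j z ji dz|].
  by apply/tor/(low _ _ ji); rewrite -gd dz linear0.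
exists (f i w); split; first by rewrite -fd dw linear0.
  by apply: tor; rewrite fK.
by move=> u /(congr1 (g i)); rewrite fK gd => /nw.
Qed.

Section Step.
Variables (x : R) (X D : complex R).
Variables (p : forall n, {linear X n -> D n}) (s : forall n, {linear D n -> X n}).
Hypothesis ext : local_extension x p s.

Let sp n := ext.2 (n - 1) n (esym (subrK _ _)).

(** The sign is that of the differential of the shift D_x[-1]. *)
Lemma diff_defect (i j k : int) (u : D i) :
  cdiff X j k (defect s i j u) = - defect s j k (cdiff D i j u).
Proof.
by rewrite /defect /= linearB /= !cdiffK linear0 subr0 sub0r.
Qed.

(** Exactness of H^(j-1)(D)_x -> H^j(X) -> H^j(D) after inverting y: the left term becomes zero, so
    vanishing can be tested in D. *)
Lemma power_torsion_lift (Y : set R) (j : int) (e : X j) :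
  (forall z : D (j - 1), cdiff D (j - 1) j z = 0 -> power_torsion Y z) ->
  cdiff X j (j + 1) e = 0 -> power_torsion Y (p j e) -> power_torsion Y e.
Proof.
move=> low de tpe y Yy; have [m [u mu]] := tpe y Yy.
(* Corrected by a boundary, the multiple y^m e lies in the kernel of [p], that is, in the copy of
   D_x. *)
pose e1 := y ^+ m *: e - cdiff X (j - 1) j (s (j - 1) u).
have pe1 : p j e1 = 0.
  by rewrite linearB linearZ /= mu ext.1 (ls_section (sp _)) subrr.
have de1 : cdiff X j (j + 1) e1 = 0.
  rewrite (linearB (cdiff X j (j + 1))) (linearZZ (cdiff X j (j + 1))) /=.
  by rewrite de cdiffK scaler0 subr0.
have [k [v kv]] := ls_surj (sp j) pe1.
have [l lv] : exists l, x ^+ l *: cdiff D (j - 1) j v = 0.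
  apply: (ls_ker (ext.2 j (j + 1) erefl)).
  apply: oppr_inj; rewrite -diff_defect -kv oppr0.
  by rewrite (linearZZ (cdiff X j (j + 1))) de1 scaler0.
have [|q [w qw]] := low (x ^+ l *: v) _ y Yy; first by rewrite linearZZ.
(* As e1 stands for v / x^k and y^q x^l v = d w, the element g standing for w / x^(l+k) bounds y^q
   e1 up to sign. *)
have [g pg gE] := ls_div_pow (sp (j - 1)) (l + k) (ls_pc (sp (j - 1)) w).
have e1E : y ^+ q *: e1 = - cdiff X (j - 1) j g.
  apply/eqP; rewrite -addr_eq0; apply/eqP; apply: (ls_inj_pow (sp j) (k := l + k)).
    by rewrite linearD linearZ /= pe1 ext.1 pg (linear0 (cdiff D _ _)) addr0 ?scaler0.
  rewrite scalerDr -(linearZZ (cdiff X (j - 1) j)) gE diff_defect -qw.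
  rewrite !(linearZZ (defect s (j - 1) j)) -kv !scalerA exprD.
  apply/eqP; rewrite subr_eq0; apply/eqP; congr (_ *: _); ring.
exists (q + m)%N, (y ^+ q *: s (j - 1) u - g).
rewrite (linearB (cdiff X (j - 1) j)) (linearZZ (cdiff X (j - 1) j)) exprD -scalerA.
have -> : y ^+ m *: e = e1 + cdiff X (j - 1) j (s (j - 1) u) by rewrite subrK.
by rewrite scalerDr e1E addrC.
Qed.

(** The obstruction to lifting the cocycle w to X is its class in H^i(D)_x, which is zero as x lies
    in [Y]. The lift is not a boundary since it maps to w. *)
Lemma torsion_bottom_extension (Y : set R) i :
  Y x -> torsion_bottom Y D i -> torsion_bottom Y X i.
Proof.
move=> Yx [low [w [dw tw nw]]].
have lowX (j : int) (e : X j) : j <= i -> cdiff X j (j + 1) e = 0 ->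
    power_torsion Y (p j e) -> power_torsion Y e.
  move=> ji; apply: power_torsion_lift => z dz.
  by apply: low; [lia | apply: cocycle_next dz; rewrite subrK].
split=> [j z ji dz|].
  apply: lowX => //; first exact: ltW.
  by apply: low => //; rewrite -ext.1 dz linear0.
have [m [u mu]] := tw x Yx.
(* With x^m w = d u, the correction g stands for u / x^m and cancels the defect of w. *)
have [g pg gE] := ls_div_pow (sp i) m (ls_pc (sp i) u).
have dsg : cdiff X i (i + 1) (s i w + g) = 0.
  have dE : cdiff X i (i + 1) (s i w) = defect s i (i + 1) w.
    by rewrite /defect /= dw linear0 subr0.
  rewrite linearD /= dE.
  have sp1 := ext.2 i (i + 1) erefl.
  apply: (ls_inj_pow sp1 (k := m)).
    by rewrite linearD /= (ls_pc sp1) ext.1 pg (linear0 (cdiff D _ _)) addr0.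
  rewrite scalerDr -(linearZZ (defect _ _ _)) -(linearZZ (cdiff X _ _)) gE mu.
  by rewrite diff_defect subrr.
have pw : p i (s i w + g) = w by rewrite linearD /= (ls_section (sp i)) pg addr0.
exists (s i w + g); split=> //; first by apply: lowX => //; rewrite pw.
by move=> v /(congr1 (p i)); rewrite pw ext.1 => /nw.
Qed.
End Step.

Lemma torsion_bottom_K_infty (Y : set R) (N : complex R) i xs :
  (forall x, x \in xs -> Y x) -> torsion_bottom Y N i ->
  torsion_bottom Y (tensor_complex (K_infty xs) N) i.
Proof.
move=> + HN; elim: xs => [|x xs IH] Yxs /=.
  have [f [g /chain_iso_sym fg]] := tensor_unit_iso N.
  exact: torsion_bottom_iso fg HN.
have [f [g /chain_iso_sym fg]] := tensor_unit_iso (K_infty xs).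
(* Tensoring R -> R_x first with [K_infty xs] and then with N follows the bracketing of [K_infty];
   the quotient (R (x) K) (x) N is then identified with K (x) N. *)
have := local_extension_tensor N (local_extension_tensor (K_infty xs)
  (loc_can_complex_extension x)).
move/torsion_bottom_extension; apply; first by apply: Yxs; rewrite inE eqxx.
apply: torsion_bottom_iso (tensor_cmap_iso N fg) _.
by apply: IH => y y_xs; apply: Yxs; rewrite inE y_xs orbT.
Qed.

Lemma torsion_bottom_cohomology (Y : set R) (C : complex R) i :
  torsion_bottom Y C i -> ~ is_zero (cohomology C i).
Proof.
by case=> _ [w [dw _ nw]] /cohomology_eq0P /(_ w dw)[u /nw].
Qed.
End PowerTorsion.

(** * Support *)

Section LocalizedComplex.
Variables (R : comPzRingType) (S : mulrClosed R) (M : complex R).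

Lemma loc_complex_diff i j (v : M i) (s : denom S) :
  cdiff (loc_complex S M) i j (frac v s) = frac (cdiff M i j v) s.
Proof. exact: loc_map_frac. Qed.

Lemma loc_complex_cocycle (i : int) (z : loc_complex S M i) :
  cdiff (loc_complex S M) i (i + 1) z = 0 ->
  exists v s, cdiff M i (i + 1) v = 0 /\ z = frac v s.
Proof.
elim/localization_ind: z => v s; rewrite loc_complex_diff.
case/frac_eq0 => u uS udv; exists (u *: v), (denomM (exist _ u uS) s).
split; first by rewrite linearZZ.
apply/fracE; exists 1; rewrite ?rpred1 //= !scale1r !scalerA.
by congr (_ *: _); ring.
Qed.

Lemma loc_complex_boundary (i : int) (v : M i) (s : denom S) (a : R) u :
  a \in S -> a *: v = cdiff M (i - 1) i u ->
  exists z, frac v s = cdiff (loc_complex S M) (i - 1) i z.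
Proof.
move=> aS av; exists (frac u (denomM (exist _ a aS) s)).
rewrite loc_complex_diff -av; apply/fracE; exists 1; rewrite ?rpred1 //=.
by rewrite !scale1r !scalerA; congr (_ *: _); ring.
Qed.

Lemma loc_complex_nonboundary (i : int) (v : M i) :
  (forall a u, a \in S -> a *: v <> cdiff M (i - 1) i u) ->
  forall z, loc_can S v <> cdiff (loc_complex S M) (i - 1) i z.
Proof.
move=> nv; elim/localization_ind => u s; rewrite loc_complex_diff.
case/fracE => a aS /=; rewrite scale1r scalerA -linearZZ.
by apply: nv; rewrite rpredM // (valP s).
Qed.
End LocalizedComplex.

Section Support.
Variable R : comPzRingType.
Implicit Types (M C : complex R) (p q : prime_ideal R).

Lemma acyclicP C : acyclic C <->
  forall (i : int) (x : C i), cdiff C i (i + 1) x = 0 -> exists u, x = cdiff C (i - 1) i u.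
Proof. by split=> h i; apply/cohomology_eq0P/h. Qed.

Lemma not_acyclicP C : ~ acyclic C <-> exists (i : int) (x : C i),
  cdiff C i (i + 1) x = 0 /\ forall u, x <> cdiff C (i - 1) i u.
Proof.
rewrite acyclicP; split=> [nC|[i [x [dx nx]]] /(_ i x dx)[u /nx]//].
apply: contrapT => nex; apply: nC => i x dx; apply: contrapT => nx.
by apply: nex; exists i, x; split=> // u xu; apply: nx; exists u.
Qed.

Lemma acyclic_loc_complex (S : mulrClosed R) M : acyclic M -> acyclic (loc_complex S M).
Proof.
move=> /acyclicP aM; apply/acyclicP => i z /loc_complex_cocycle[v [s [dv ->]]].
have [u vu] := aM i v dv.
by apply: (@loc_complex_boundary _ _ _ _ _ _ 1 u); rewrite ?rpred1 ?scale1r.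
Qed.

Lemma acyclic_supp0 M : acyclic M -> supp M = set0.
Proof.
(* For the empty sequence the support condition asks that R (x) M_p, hence M_p, have cohomology. *)
move=> aM; apply/seteqP; split=> p //= /(_ [::])[|i] //; apply.
have [f [g [fd fK gK]]] := tensor_unit_iso (loc_complex (prime_compl p) M).
apply/cohomology_eq0P => x dx.
have /acyclicP/(_ i (f i x)) := acyclic_loc_complex (S := prime_compl p) aM.
case=> [|u fu]; first by rewrite -fd dx linear0.
exists (g _ u); apply: (can_inj (fK i)); by rewrite fu fd gK.
Qed.

Lemma torsion_bottom_supp M p i :
  torsion_bottom [set y | y \in p] (loc_complex (prime_compl p) M) i -> supp M p.
Proof.
move=> tb xs xs_p; exists i; apply: torsion_bottom_cohomology.
exact: torsion_bottom_K_infty tb.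
Qed.

(** If v is a cocycle, p is a minimal prime over the annihilator of its class. Containment of the
    annihilator keeps the class nonzero over M_p; minimality makes it torsion for every element of
    p. *)
Lemma boundary_prime M (i : int) (v : M i) (S0 : set R) :
  S0 1 -> (forall a b, S0 a -> S0 b -> S0 (a * b)) ->
  (forall a u, S0 a -> a *: v <> cdiff M (i - 1) i u) ->
  exists p, [/\ forall a, S0 a -> a \notin p,
    forall y, y \in p -> exists s k u,
      s \notin p /\ (s * y ^+ k) *: v = cdiff M (i - 1) i u &
    forall z, loc_can (prime_compl p) v <>
      cdiff (loc_complex (prime_compl p) M) (i - 1) i z].
Proof.
move=> S01 S0M nv; pose I := [set a | exists u, a *: v = cdiff M (i - 1) i u].
have S0I a : S0 a -> ~ I a by move=> Sa [u /(nv a u Sa)].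
have [||||||p [Ip S0p pI]] := @prime_avoiding R I S0 => //.
- by exists 0; rewrite scale0r linear0.
- by move=> a b [u au] [w bw]; exists (u + w); rewrite scalerDl au bw linearD.
- by move=> a b [u bu]; exists (a *: u); rewrite -scalerA bu linearZZ.
exists p; split=> // [y /pI[s [k [sp [u su]]]]|]; first by exists s, k, u.
by apply: loc_complex_nonboundary => a u ap au; move/negP: ap; apply; apply: Ip; exists u.
Qed.

Lemma supp_bounded_below M (n : int) :
  (forall i : int, i < n -> is_zero (cohomology M i)) -> ~ acyclic M ->
  exists p, supp M p.
Proof.
move=> Mn nM.
have [k [kH kmin]] : exists k : nat, ~ is_zero (cohomology M (n + k%:Z)) /\
    forall l, (l < k)%N -> is_zero (cohomology M (n + l%:Z)).
  have ex : exists k : nat, `[< ~ is_zero (cohomology M (n + k%:Z)) >].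
    apply: contrapT => nex; apply: nM => i.
    have [ni|] := leP n i; last exact: Mn.
    apply: contrapT => nzi; apply: nex; exists `|i - n|%N; apply/asboolP.
    by have -> : n + `|i - n|%N%:Z = i by lia.
  case: (ex_minnP ex) => k /asboolP kH kmin; exists k; split=> // l lk.
  by apply: contrapT => /asboolP/kmin; rewrite leqNgt lk.
set i := n + k%:Z in kH.
have low (j : int) : j < i -> is_zero (cohomology M j).
  move=> ji; have [nj|] := leP n j; last exact: Mn.
  have -> : j = n + `|j - n|%N%:Z by lia.
  by apply: kmin; move: ji; rewrite /i; lia.
have [v [dv nv]] : exists v : M i, cdiff M i (i + 1) v = 0 /\
    forall u, v <> cdiff M (i - 1) i u.
  apply: contrapT => nex; apply/kH/cohomology_eq0P => v dv; apply: contrapT => nv.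
  by apply: nex; exists v; split=> // u vu; apply: nv; exists u.
have [||a u ->|p [_ pI nvp]] := @boundary_prime M i v [set 1] => //=.
- by move=> a b -> ->; rewrite mulr1.
- by rewrite scale1r.
exists p; apply: (@torsion_bottom_supp _ _ i); split=> [j z ji|].
  case/loc_complex_cocycle => w [s [dw ->]] y _; exists 0%N.
  have /cohomology_eq0P/(_ w dw)[u wu] := low j ji.
  have [|t tE] := @loc_complex_boundary R (prime_compl p) M j w s 1 u (rpred1 _).
    by rewrite scale1r.
  by exists t; rewrite expr0 scale1r.
exists (loc_can (prime_compl p) v); split=> //.
  by rewrite loc_complex_diff dv; apply/frac_eq0; exists 1; rewrite ?rpred1 ?scaler0.
(* The factor s is invertible over M_p, so y^l alone makes the class a boundary. *)
move=> y /pI[s [l [u [sp su]]]]; exists l.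
have [|z zE] := @loc_complex_boundary R (prime_compl p) M i (y ^+ l *: v)
  (denom1 _) s u sp; first by rewrite scalerA.
by exists z; rewrite -zE scale_frac.
Qed.

(** Without a minimal prime, iterating a choice of strictly smaller ones gives an infinite strictly
    descending chain. *)
Lemma minimal_prime (P : prime_ideal R -> Prop) : spec_dcc R -> (exists p, P p) ->
  exists2 p, P p & forall q, {subset q <= p} -> P q -> {subset p <= q}.
Proof.
move=> dcc [p0 Pp0]; apply: contrapT => nmin.
have /choice[f fP] : forall p : {p | P p}, exists q : {q | P q},
    {subset sval q <= sval p} /\ ~ {subset sval p <= sval q}.
  move=> [p Pp]; apply: contrapT => nq; apply: nmin; exists p => // q qp Pq.
  by apply: contrapT => pq; apply: nq; exists (exist _ q Pq).
pose c n := iter n f (exist _ p0 Pp0).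
have [|N cN] := dcc (fun n => sval (c n)); first by move=> n; apply: (fP (c n)).1.
by apply: (fP (c N)).2 => a; rewrite -(cN N.+1).
Qed.

Lemma supp_dcc M : spec_dcc R -> ~ acyclic M -> exists p, supp M p.
Proof.
move=> dcc nM.
have nonacyclic p i (v : M i) : cdiff M i (i + 1) v = 0 ->
    (forall z, loc_can (prime_compl p) v <>
      cdiff (loc_complex (prime_compl p) M) (i - 1) i z) ->
    ~ acyclic (loc_complex (prime_compl p) M).
  move=> dv nv; apply/not_acyclicP; exists i, (loc_can (prime_compl p) v).
  split=> //; rewrite loc_complex_diff dv.
  by apply/frac_eq0; exists 1; rewrite ?rpred1 ?scaler0.
have [p /not_acyclicP[i [w [dw nw]]] pmin] : exists2 p,
    ~ acyclic (loc_complex (prime_compl p) M) & forall q, {subset q <= p} ->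
    ~ acyclic (loc_complex (prime_compl q) M) -> {subset p <= q}.
  apply: minimal_prime dcc _; have /not_acyclicP[i [v [dv nv]]] := nM.
  have [||a u ->|p [_ _ nvp]] := @boundary_prime M i v [set 1] => //=.
  - by move=> a b -> ->; rewrite mulr1.
  - by rewrite scale1r.
  by exists p; apply: nonacyclic nvp.
exists p; apply: (@torsion_bottom_supp _ _ i).
(* This holds in all degrees, so any nonzero class over M_p may serve as the bottom one. *)
have tor (j : int) (z : loc_complex (prime_compl p) M j) :
    cdiff (loc_complex (prime_compl p) M) j (j + 1) z = 0 ->
    power_torsion [set y | y \in p] z.
  case/loc_complex_cocycle => v [s [dv ->]] y /= yp {z}; apply: contrapT => ntor.
  (* If no power of y kills the class over M_p, this set misses its annihilator. A prime q avoiding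
     the set lies in p, omits y and has M_q not acyclic, against the minimality of p. *)
  pose S0 := [set a | exists t k, t \notin p /\ a = t * y ^+ k].
  have [|||q [S0q _ nvq]] := @boundary_prime M j v S0.
  - by exists 1, 0%N; rewrite expr0 mulr1; split=> //; apply: prime_proper.
  - move=> _ _ [t [k [tp ->]]] [t' [k' [tp' ->]]].
    exists (t * t'), (k + k')%N; split; first exact: (prime_compl_mulr_closed p).2.
    by rewrite exprD; ring.
  - move=> _ u [t [k [tp ->]]] tyv; apply: ntor; exists k.
    have [|z zE] := @loc_complex_boundary R (prime_compl p) M j (y ^+ k *: v)
      s t u tp; first by rewrite scalerA.
    by exists z; rewrite -zE scale_frac.
  have qp : {subset q <= p}.
    move=> a aq; apply: contraLR aq => ap; apply: S0q.
    by exists a, 0%N; rewrite expr0 mulr1.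
  have /negP : y \notin q.
    by apply: S0q; exists 1, 1%N; rewrite expr1 mul1r; split=> //; apply: prime_proper.
  by apply; apply: (pmin q qp _ y yp); apply: nonacyclic nvq.
by split=> [j z _|]; [apply: tor | exists w; split=> //; apply: tor].
Qed.
End Support.

Theorem theorem1p2 (R : comPzRingType) (M : complex R) :
  ((exists n : int, forall i : int, i < n -> is_zero (cohomology M i)) \/
   spec_dcc R) ->
  (supp M = set0 <-> acyclic M).
Proof.
move=> hyp; split=> [supp0|]; last exact: acyclic_supp0.
apply: contrapT => nM.
have [p] : exists p, supp M p.
  by case: hyp => [[n Mn]|dcc]; [apply: supp_bounded_below Mn nM | apply: supp_dcc].
by rewrite supp0.
Qed.
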